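(* For any integer $k\ge 2$, there is an irreducible algebraic curve with one place at infinity which has at least $k$ inequivalent embeddings in the plane $\mathbb{C}^2$. That is, for every $k\ge2$ there are irreducible polynomials $f_1,\dots,f_k\in\mathbb{C}[x,y]$ such that each curve $\{f_i=0\}$ has one place at infinity, the $\mathbb{C}$-algebras $\mathbb{C}[x,y]/\langle f_i\rangle$, $i=1,\dots,k$, are pairwise isomorphic, and for $i\neq j$ there is no automorphism of $\mathbb{C}^2$ that takes the curve $\{f_i=0\}$ onto the curve $\{f_j=0\}$.
   Context: Two curves $\{p(x,y)=0\}$ and $\{q(x,y)=0\}$ in $\mathbb{C}^2$ are called isomorphic if the algebras $\mathbb{C}[x,y]/\langle p\rangle$ and $\mathbb{C}[x,y]/\langle q\rangle$ are isomorphic, where $\langle p\rangle$ denotes the ideal generated by $p$. Two such curves (regarded as embeddings of the same abstract curve in $\mathbb{C}^2$) are called equivalent if there is a polynomial automorphism of $\mathbb{C}^2$ that takes one of them onto the other. An irreducible affine plane curve has one place at infinity if the normalization of its closure in the projective plane has exactly one point lying over the line at infinity. *)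

(* Defs.v *)
From HB Require Import structures.
From mathcomp Require Import all_boot all_order all_algebra.
From mathcomp Require Import generic_quotient ring_quotient.
From mathcomp Require Import boolp reals.
From mathcomp Require Import complex.
From mathcomp Require Import mpoly.

Set Implicit Arguments.
Unset Strict Implicit.
Unset Printing Implicit Defensive.

Import GRing.Theory.
Local Open Scope ring_scope.
Local Open Scope quotient_scope.

(* [{ideal_quot I}] requires a proper ideal, as its instance is a nonzero ring.
   The quotient of a commutative algebra by an arbitrary principal ideal is
   therefore built here, on top of the library's Z-module quotient. It may be
   zero, so it cannot be an [algType], whose instances are nonzero rings: it is
   a [comPzRingType] and an [lmodType F], related by [quot_scaleAl]. *)
Section PrincipalQuotient.
Variables (F : fieldType) (A : comAlgType F) (a : A).

Definition principal : {pred A} := fun g => `[< exists h : A, g = h * a >].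

Lemma principalP g : reflect (exists h : A, g = h * a) (g \in principal).
Proof. exact: asboolP. Qed.

Lemma principalM h g : g \in principal -> h * g \in principal.
Proof. by case/principalP=> u ->; apply/principalP; exists (h * u); rewrite mulrA. Qed.

Lemma principal_zmod_closed : zmod_closed principal.
Proof.
split; first by apply/principalP; exists 0; rewrite mul0r.
move=> x y /principalP[u ->] /principalP[v ->].
by apply/principalP; exists (u - v); rewrite mulrBl.
Qed.

HB.instance Definition _ :=
  GRing.isZmodClosed.Build A principal principal_zmod_closed.

Definition principal_quot : Type := Quotient.quot principal.

HB.instance Definition _ := GRing.Zmodule.on principal_quot.
HB.instance Definition _ : EqQuotient A (Quotient.equiv principal) principal_quot :=
  EqQuotient.on principal_quot.
HB.instance Definition _ :=
  ZmodQuotient.on principal_quot.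

Local Notation Q := principal_quot.

Definition quot_class (g : A) : Q := \pi_Q g.

Lemma quot_classP g h : quot_class g = quot_class h <-> g - h \in principal.
Proof.
rewrite /quot_class -Quotient.equivE; split.
  by move/eqP; rewrite eqmodE.
by move=> gh; apply/eqP; rewrite eqmodE.
Qed.

Lemma quot_class_repr (x : Q) : quot_class (repr x) = x.
Proof. exact: reprK. Qed.

Lemma quot_classB : zmod_morphism quot_class.
Proof. by move=> x y; rewrite /quot_class !piE. Qed.

HB.instance Definition _ := GRing.isZmodMorphism.Build A Q quot_class quot_classB.

Definition quot_mul (x y : Q) : Q := quot_class (repr x * repr y).
Definition quot_scale (c : F) (x : Q) : Q := quot_class (c *: repr x).

Lemma quot_class_mul g h : quot_mul (quot_class g) (quot_class h) = quot_class (g * h).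
Proof.
apply/quot_classP; set g' := repr _; set h' := repr _.
have gP : g' - g \in principal by apply/quot_classP/quot_class_repr.
have hP : h' - h \in principal by apply/quot_classP/quot_class_repr.
rewrite -[_ * _](addrNK (g' * h)) -mulrBr -addrA -mulrBl rpredD //.
  exact: principalM.
by rewrite mulrC; exact: principalM.
Qed.

Lemma quot_class_scale c g : quot_scale c (quot_class g) = quot_class (c *: g).
Proof.
apply/quot_classP; set g' := repr _.
have gP : g' - g \in principal by apply/quot_classP/quot_class_repr.
by rewrite -scalerBr -mulr_algl principalM.
Qed.

Definition quot_simp := (quot_class_mul, quot_class_scale).

Lemma quot_mulA : associative quot_mul.
Proof.
move=> x y z; rewrite -[x]quot_class_repr -[y]quot_class_repr -[z]quot_class_repr.
by rewrite !quot_class_mul mulrA.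
Qed.

Lemma quot_mulC : commutative quot_mul.
Proof. by move=> x y; rewrite /quot_mul mulrC. Qed.

Lemma quot_mul1 : left_id (quot_class 1) quot_mul.
Proof. by move=> x; rewrite -[x]quot_class_repr quot_class_mul mul1r. Qed.

Lemma quot_mulDl : left_distributive quot_mul +%R.
Proof.
move=> x y z; rewrite -[x]quot_class_repr -[y]quot_class_repr -[z]quot_class_repr.
by rewrite !quot_class_mul -!raddfD !quot_class_mul mulrDl.
Qed.

HB.instance Definition _ :=
  GRing.Zmodule_isComPzRing.Build Q quot_mulA quot_mulC quot_mul1 quot_mulDl.

Lemma quot_scaleA b c (x : Q) :
  quot_scale b (quot_scale c x) = quot_scale (b * c) x.
Proof. by rewrite -[x]quot_class_repr !quot_class_scale scalerA. Qed.

Lemma quot_scale1 : left_id 1 quot_scale.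
Proof. by move=> x; rewrite -[x]quot_class_repr quot_class_scale scale1r. Qed.

Lemma quot_scaleDr : right_distributive quot_scale +%R.
Proof.
move=> c x y; rewrite -[x]quot_class_repr -[y]quot_class_repr.
by rewrite !quot_class_scale -!raddfD quot_class_scale.
Qed.

Lemma quot_scaleDl (x : Q) : {morph quot_scale^~ x : b c / b + c}.
Proof.
move=> b c; rewrite -[x]quot_class_repr.
by rewrite !quot_class_scale -raddfD scalerDl.
Qed.

HB.instance Definition _ := GRing.Zmodule_isLmodule.Build F Q
  quot_scaleA quot_scale1 quot_scaleDr quot_scaleDl.

Lemma quot_scaleAl (c : F) (x y : Q) : c *: (x * y) = (c *: x) * y.
Proof.
rewrite -[x]quot_class_repr -[y]quot_class_repr.
by rewrite /GRing.mul /GRing.scale /= !quot_simp scalerAl.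
Qed.

Lemma quot_class_monoid : monoid_morphism quot_class.
Proof. by split=> // g h; rewrite -quot_class_mul. Qed.

HB.instance Definition _ :=
  GRing.isMonoidMorphism.Build A Q quot_class quot_class_monoid.

Lemma quot_class_scalable : scalable quot_class.
Proof. by move=> c g; rewrite -quot_class_scale. Qed.

HB.instance Definition _ :=
  GRing.isScalable.Build F A Q *:%R quot_class quot_class_scalable.

End PrincipalQuotient.

Definition irreducible_elt (A : unitRingType) (p : A) : Prop :=
  [/\ p != 0, p \isn't a GRing.unit &
      forall g h : A, p = g * h -> g \is a GRing.unit \/ h \is a GRing.unit].

Section PlaneCurves.
Variable C : fieldType.
Implicit Types (f g : {mpoly C[2]}) (v : 'I_2 -> C) (P : 'I_3 -> C).

Local Notation coord_ring f := (principal_quot f).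

Definition isomorphic_curves f g : Prop :=
  exists phi : {rmorphism coord_ring f -> coord_ring g},
    scalable phi /\ bijective phi.

Definition polymap (F : 2.-tuple {mpoly C[2]}) v : 'I_2 -> C :=
  fun i => (tnth F i).@[v].

Definition poly_automorphism (F : 2.-tuple {mpoly C[2]}) : Prop :=
  exists G : 2.-tuple {mpoly C[2]},
    (forall v, polymap G (polymap F v) =1 v) /\
    (forall v, polymap F (polymap G v) =1 v).

Definition equivalent_curves f g : Prop :=
  exists F : 2.-tuple {mpoly C[2]}, poly_automorphism F /\
    forall w : 'I_2 -> C,
      g.@[w] = 0 <-> exists2 v, f.@[v] = 0 & polymap F v =1 w.

(* The plane is embedded in the projective plane by (x, y) |-> [x : y : 1], so
   that the line at infinity is the vanishing locus of the last coordinate. *)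
Definition proj_of_affine v : 'I_3 -> C :=
  fun i => if unlift ord_max i is Some j then v j else 1.

Definition dehomog (G : {mpoly C[3]}) : {mpoly C[2]} :=
  G \mPo [tuple (if unlift ord_max i is Some j then 'X_j else 1) | i < 3].

Definition proj_eq P P' : Prop :=
  exists2 c : C, c != 0 & forall i, P' i = c * P i.

Definition at_infinity P : Prop := P ord_max = 0 /\ exists i, P i != 0.

(* Zariski closure in the projective plane of the affine curve f = 0 *)
Definition in_proj_closure f P : Prop :=
  forall (d : nat) (G : {mpoly C[3]}), G \is d.-homog ->
    (forall v, f.@[v] = 0 -> G.@[proj_of_affine v] = 0) -> G.@[P] = 0.

Section Subrings.
Variables (K : fieldType) (B : K -> Prop).

Definition integral_closure (z : K) : Prop :=
  exists p : {poly K}, [/\ p \is monic, forall i, B p`_i & root p z].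

Definition is_ideal (M : K -> Prop) : Prop :=
  [/\ forall x, M x -> B x, M 0,
      forall x y, M x -> M y -> M (x + y) &
      forall b x, B b -> M x -> M (b * x)].

Definition maximal_ideal (M : K -> Prop) : Prop :=
  [/\ is_ideal M, ~ M 1 &
      forall J, is_ideal J -> (forall x, M x -> J x) -> ~ J 1 ->
        forall x, J x -> M x].
End Subrings.

Section Normalization.
Variables (f : {mpoly C[2]}) (K : fieldType) (iota : {rmorphism coord_ring f -> K}).

(* K, with the embedding iota, is the field of fractions of the coordinate ring *)
Definition is_function_field : Prop :=
  injective iota /\
  forall z : K, exists g h : coord_ring f, h != 0 /\ z = iota g / iota h.

Definition restrict_form (G : {mpoly C[3]}) : K :=
  iota (quot_class f (dehomog G)).

(* If P is on the closure of the curve and H(P) != 0, then H does not vanish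
   identically on the curve, so the denominator below is nonzero. *)
Definition local_ring P (z : K) : Prop :=
  exists (d : nat) (G H : {mpoly C[3]}),
    [/\ G \is d.-homog, H \is d.-homog, H.@[P] != 0 &
        z = restrict_form G / restrict_form H].

(* The normalization of the closure of the curve is, near P, the spectrum of the
   integral closure in K of the local ring at P. All the maximal ideals of this
   integral closure lie over the maximal ideal of the local ring, hence they
   are the points of the normalization that lie over P. *)
Definition normalization_point P (M : K -> Prop) : Prop :=
  in_proj_closure f P /\ maximal_ideal (integral_closure (local_ring P)) M.
End Normalization.

(* The function field is unique up to a unique isomorphism, so the choice of K is
   immaterial. *)
Definition one_place_at_infinity f : Prop :=
  exists (K : fieldType) (iota : {rmorphism coord_ring f -> K}),
    is_function_field iota /\
    exists (P : 'I_3 -> C) (M : K -> Prop),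
      [/\ at_infinity P, normalization_point iota P M &
          forall P' M', at_infinity P' -> normalization_point iota P' M' ->
            proj_eq P P' /\ forall z, M z <-> M' z].

End PlaneCurves.

(* Main.v *)
(** Put [n = d e] and let [A = C[u, v]] with [u^2 = v - v^n - 1]. Since
    [v = u^2 + (v^d)^e + 1], the elements [u] and [v^d] generate [A], with the
    single relation [f = y - (x^2 + y^e + 1)^d]: for a fixed [n], all these plane
    curves are isomorphic. As [n] is odd, the degree of the norm
    [g0^2 - (v - v^n - 1) g1^2] of [g0(v) + g1(v) u] is a valuation, the pole order
    at a place at infinity. Functions vanishing to a high order there lie in the
    local ring of the closure at its only point at infinity, so the valuation ring
    is the integral closure of that local ring, and the place is unique.

    If an automorphism [F] takes [f = 0] onto [f' = 0], the Nullstellensatz gives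
    [f' o F = c f] for a constant [c], so [F] maps critical points to critical
    points and multiplies critical values by [c]. The critical points of [f] are
    the [(0, y)] with [n y^(e-1) (y^e + 1)^(d-1) = 1]; the sum of the [n - 1]
    critical values is [- (e - 1)] and the sum of their squares is [e - 1]. Hence
    [c = 1], and [e] is determined by the equivalence class of [f]. The theorem
    follows by taking [n = 3^k] and [e = 3, 9, ..., 3^k]. *)

Require Import Defs.
From HB Require Import structures.
From mathcomp Require Import all_boot all_order all_algebra.
From mathcomp Require Import reals complex mpoly.
From mathcomp Require Import boolp ring zify fraction separable generic_quotient.

Set Implicit Arguments.
Unset Strict Implicit.
Unset Printing Implicit Defensive.

Import Order.TTheory GRing.Theory Num.Theory.
Local Open Scope ring_scope.
Local Open Scope quotient_scope.
Local Notation "x %:F" := (tofrac x).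

(** * The coordinate ring [C[u, v]], [u^2 = v - v^n - 1] *)

(* Indexing the odd degrees by [h] makes the ring below a domain for every
   value of the index, so that it has a canonical [idomainType] structure. *)
Definition hyp_deg (h : nat) := h.*2.+3.

Definition hyp_poly (C : fieldType) (h : nat) : {poly C} :=
  'X - 'X^(hyp_deg h) - 1.

(* [(a0, a1)] stands for [a0(v) + a1(v) u] modulo [u^2 = v - v^n - 1]. *)
Definition hyp (C : fieldType) (h : nat) : Type := ({poly C} * {poly C})%type.

Section HyperellipticRing.
Variables (C : fieldType) (h : nat).
Local Notation n := (hyp_deg h).
Local Notation rho := (hyp_poly C h).
Local Notation A := (hyp C h).
Implicit Types a b : A.

HB.instance Definition _ := GRing.Zmodule.copy A ({poly C} * {poly C})%type.

Definition hyp_mul a b : A := (a.1 * b.1 + rho * a.2 * b.2, a.1 * b.2 + a.2 * b.1).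
Definition hyp_one : A := (1, 0).

Fact hyp_mulA : associative hyp_mul.
Proof. by move=> a b c; congr (_, _) => /=; ring. Qed.
Fact hyp_mulC : commutative hyp_mul.
Proof. by move=> a b; congr (_, _) => /=; ring. Qed.
Fact hyp_mul1 : left_id hyp_one hyp_mul.
Proof. by case=> a0 a1; congr (_, _) => /=; ring. Qed.
Fact hyp_mulDl : left_distributive hyp_mul +%R.
Proof. by move=> a b c; congr (_, _) => /=; ring. Qed.
Fact hyp_one_neq0 : hyp_one != 0.
Proof. by apply/eqP => -[] /eqP; rewrite oner_eq0. Qed.

HB.instance Definition _ := GRing.Zmodule_isComNzRing.Build A
  hyp_mulA hyp_mulC hyp_mul1 hyp_mulDl hyp_one_neq0.

Lemma hypM a b : a * b = (a.1 * b.1 + rho * a.2 * b.2, a.1 * b.2 + a.2 * b.1).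
Proof. by []. Qed.

Definition hyp_base (p : {poly C}) : A := (p, 0).

Fact hyp_base_zmod : zmod_morphism hyp_base.
Proof. by move=> x y; congr (_, _) => /=; rewrite ?subr0. Qed.
HB.instance Definition _ := GRing.isZmodMorphism.Build {poly C} A hyp_base hyp_base_zmod.
Fact hyp_base_monoid : monoid_morphism hyp_base.
Proof. by split=> // x y; rewrite hypM /hyp_base /=; congr (_, _); ring. Qed.
HB.instance Definition _ := GRing.isMonoidMorphism.Build {poly C} A hyp_base hyp_base_monoid.

(** Invertibility is bare existence of an inverse, which is then chosen classically: the unit
    structure only serves to reach the integral domain, hence the fraction field. *)
Definition hyp_unit : pred A := fun a => `[< exists b, b * a = 1 >].
Definition hyp_inv a : A :=
  if pselect (exists b, b * a = 1) is left e then projT1 (cid e) else a.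

Fact hyp_mulVr : {in hyp_unit, left_inverse 1 hyp_inv *%R}.
Proof.
move=> a /asboolP ex; rewrite /hyp_inv; case: pselect => // e.
exact: projT2 (cid e).
Qed.
Fact hyp_unitPl a b : b * a = 1 -> hyp_unit a.
Proof. by move=> ba1; apply/asboolP; exists b. Qed.
Fact hyp_inv_out : {in [predC hyp_unit], hyp_inv =1 id}.
Proof.
by move=> a /asboolPn nex; rewrite /hyp_inv; case: pselect.
Qed.

HB.instance Definition _ := GRing.ComNzRing_hasMulInverse.Build A
  hyp_mulVr hyp_unitPl hyp_inv_out.

Definition hyp_norm a : {poly C} := a.1 ^+ 2 - rho * a.2 ^+ 2.

Lemma hyp_normM : {morph hyp_norm : a b / a * b}.
Proof. by move=> a b; rewrite /hyp_norm hypM /=; ring. Qed.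

Definition hyp_conj a : A := (a.1, - a.2).

Lemma hyp_conjM a : hyp_conj a * a = hyp_base (hyp_norm a).
Proof. by rewrite hypM /hyp_base /hyp_norm /=; congr (_, _); ring. Qed.

Lemma size_hyp_poly : size rho = n.+1.
Proof.
rewrite /hyp_poly addrAC addrC size_polyDl ?size_polyN ?size_polyXn //.
by rewrite size_XsubC.
Qed.

Lemma hyp_poly_neq0 : rho != 0.
Proof. by rewrite -size_poly_eq0 size_hyp_poly. Qed.

(* The order of the pole at infinity plus two, or 0 for the zero element. *)
Definition hyp_size a : nat :=
  maxn (size a.1).*2 (if a.2 == 0 then 0 else (size a.2).*2 + n).

Lemma size_sqr (p : {poly C}) : size (p ^+ 2) = (size p).*2.-1.
Proof.
have [->|p0] := eqVneq p 0; first by rewrite expr0n size_poly0.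
by rewrite expr2 size_mul // addnn.
Qed.

(** Since [n] is odd, the two terms of the norm have degrees of opposite parity whenever both are
    nonzero, so their leading terms never cancel. The predecessor of 0 being 0 covers [a = 0]. *)
Lemma hyp_size_norm a : size (hyp_norm a) = (hyp_size a).-1.
Proof.
rewrite /hyp_norm /hyp_size; case: eqP => [->|/eqP a2].
  rewrite expr0n mulr0 subr0 maxn0.
  exact: size_sqr.
have s2 : size (rho * a.2 ^+ 2) = (n + (size a.2).*2).-1.
  rewrite size_mul ?expf_neq0 ?hyp_poly_neq0 // size_hyp_poly size_sqr.
  have := a2; rewrite -size_poly_gt0; lia.
have s1 := size_sqr a.1.
have p2 := a2; rewrite -size_poly_gt0 in p2.
have ne : (size (a.1 ^+ 2)) <> (size (rho * a.2 ^+ 2)).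
  rewrite s1 s2 /hyp_deg; lia.
have [lt|lt|//] := ltngtP (size (a.1 ^+ 2)) (size (rho * a.2 ^+ 2)).
- rewrite addrC size_polyDl ?size_polyN // s2; move: lt; rewrite s1 s2; lia.
- rewrite size_polyDl ?size_polyN // s1; move: lt; rewrite s1 s2; lia.
Qed.

Lemma hyp_size_eq0 a : (hyp_size a == 0) = (a == 0).
Proof.
case: a => a0 a1; rewrite /hyp_size -leqn0 geq_max /= !leqn0 double_eq0 size_poly_eq0.
rewrite -[RHS]/((a0 == 0) && (a1 == 0)); congr (_ && _).
by case: (a1 =P 0) => // _; rewrite /hyp_deg addn_eq0 andbF.
Qed.

Lemma hyp_size_gt1 a : a != 0 -> (1 < hyp_size a)%N.
Proof.
move=> a0; rewrite ltn_neqAle lt0n hyp_size_eq0 a0 andbT /hyp_size.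
apply/eqP; case: eqP => _; rewrite /hyp_deg; lia.
Qed.

Lemma hyp_norm_eq0 a : (hyp_norm a == 0) = (a == 0).
Proof.
rewrite -size_poly_eq0 hyp_size_norm; have [->|a0] := eqVneq a 0.
  by have /eqP -> : hyp_size 0 == 0%N by rewrite hyp_size_eq0.
by have := hyp_size_gt1 a0; case: (hyp_size a) => [|[|?]].
Qed.

Fact hyp_integral : GRing.integral_domain_axiom A.
Proof.
by move=> a b /eqP; rewrite -hyp_norm_eq0 hyp_normM mulf_eq0 !hyp_norm_eq0.
Qed.

HB.instance Definition _ := GRing.ComUnitRing_isIntegral.Build A hyp_integral.

(** Multiplicativity of the norm makes pole orders additive; the 2 is the offset between [hyp_size]
    and the pole order. *)
Lemma hyp_sizeM a b : a != 0 -> b != 0 ->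
  (hyp_size (a * b)%R + 2 = hyp_size a + hyp_size b)%N.
Proof.
move=> a0 b0; have := hyp_size_norm (a * b).
rewrite hyp_normM size_mul ?hyp_norm_eq0 // !hyp_size_norm.
have := hyp_size_gt1 a0; have := hyp_size_gt1 b0.
have := hyp_size_gt1 (mulf_neq0 a0 b0); lia.
Qed.

Lemma hyp_sizeX a k : a != 0 -> (hyp_size (a ^+ k) = k * (hyp_size a - 2) + 2)%N.
Proof.
move=> a0; elim: k => [|k IH].
  by rewrite expr0 /hyp_size /= size_poly1 eqxx.
have := hyp_sizeM a0 (expf_neq0 k a0); rewrite -exprS IH.
have := hyp_size_gt1 a0; lia.
Qed.

Lemma hyp_size_leP a m :
  reflect (((size a.1).*2 <= m)%N /\ (a.2 != 0 -> ((size a.2).*2 + n <= m)%N))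
    (hyp_size a <= m)%N.
Proof.
rewrite /hyp_size geq_max; apply: (iffP andP) => -[le1].
  by case: eqP => // _ le2; split.
by case: eqP => // _ le2; split => //; exact: le2.
Qed.

(** The ultrametric inequality. *)
Lemma hyp_sizeD a b m :
  (hyp_size a <= m)%N -> (hyp_size b <= m)%N -> (hyp_size (a + b)%R <= m)%N.
Proof.
move=> /hyp_size_leP[a1 a2] /hyp_size_leP[b1 b2]; apply/hyp_size_leP.
rewrite -[(a + b).1]/(a.1 + b.1) -[(a + b).2]/(a.2 + b.2); split.
  by move: (size_polyD a.1 b.1); lia.
move: (size_polyD a.2 b.2).
have [->|na] := eqVneq a.2 0; first by rewrite add0r => _ /b2.
have [->|nb] := eqVneq b.2 0; first by rewrite addr0 => _ _; exact: a2.
by move: (a2 na) (b2 nb); lia.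
Qed.

Lemma hyp_sizeN a : hyp_size (- a) = hyp_size a.
Proof. by rewrite /hyp_size /= !size_polyN oppr_eq0. Qed.

Definition hyp_const (c : C) : A := hyp_base c%:P.
HB.instance Definition _ := GRing.RMorphism.copy hyp_const (hyp_base \o polyC).

Definition hyp_v : A := hyp_base 'X.
Definition hyp_u : A := (0, 1).

Lemma hyp_u2 : hyp_u ^+ 2 = hyp_base rho.
Proof. by rewrite expr2 hypM /hyp_base /=; congr (_, _); ring. Qed.

Lemma hyp_size_const c : (hyp_size (hyp_const c) <= 2)%N.
Proof. by rewrite /hyp_size /= eqxx maxn0 size_polyC; case: eqP. Qed.

(* The residue field at infinity is [C], because the place is unique. *)
Lemma hyp_residue a b : b != 0 -> (hyp_size a <= hyp_size b)%N ->
  exists c : C, (hyp_size (a - hyp_const c * b)%R < hyp_size b)%N.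
Proof.
move=> b0 le; have [lt|eq_size] := leqP (hyp_size b) (hyp_size a); last first.
  by exists 0; rewrite rmorph0 mul0r subr0.
have {le lt}eq_size : hyp_size a = hyp_size b by apply/eqP; rewrite eqn_leq le.
(* Two polynomials of equal size: a scalar multiple of one cancels the leading term of the other. *)
have lead (p q : {poly C}) : q != 0 -> size p = size q ->
    (size (p - (lead_coef p / lead_coef q)%:P * q)%R < size q)%N.
  move=> q0 pq.
  have r_le : (size (p - (lead_coef p / lead_coef q)%:P * q)%R <= size q)%N.
    rewrite (leq_trans (size_polyD _ _)) // size_polyN geq_max pq leqnn mul_polyC.
    exact: size_scale_leq.
  rewrite ltn_neqAle r_le andbT; apply/eqP => eqs.
  have := size_poly_gt0 q; rewrite q0 => sq.
  have /eqP : lead_coef (p - (lead_coef p / lead_coef q)%:P * q) = 0.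
    rewrite lead_coefE eqs coefB coefCM -[in X in X - _]pq -!lead_coefE.
    by rewrite divfK ?lead_coef_eq0 // subrr.
  by rewrite lead_coef_eq0 => /eqP r0; move: sq; rewrite -eqs r0 size_poly0.
have s_gt : (0 < hyp_size b)%N by apply: leq_trans (hyp_size_gt1 b0).
have dec c : (hyp_size (a - hyp_const c * b)%R < hyp_size b)%N <->
   ((size (a.1 - c%:P * b.1)%R).*2 < hyp_size b)%N /\
   (a.2 - c%:P * b.2 != 0 -> ((size (a.2 - c%:P * b.2)%R).*2 + n < hyp_size b)%N).
  have -> : a - hyp_const c * b = (a.1 - c%:P * b.1, a.2 - c%:P * b.2).
    by rewrite hypM /=; congr (_, _) => /=; ring.
  rewrite -(prednK s_gt) ltnS; split => [/hyp_size_leP //|?]; exact/hyp_size_leP.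
have [/hyp_size_leP ha /hyp_size_leP hb] := (leqnn (hyp_size a), leqnn (hyp_size b)).
rewrite eq_size in ha.
have sz c (p q : {poly C}) m : (size p <= m)%N -> (size q <= m)%N ->
   (size (p - c%:P * q)%R <= m)%N.
  move=> pm qm; rewrite (leq_trans (size_polyD _ _)) // size_polyN geq_max pm.
  by rewrite mul_polyC (leq_trans (size_scale_leq _ _)).
case: ha => ha1 ha2; case: hb => hb1 hb2.
(* The parity of [hyp_size b] tells which component of [b] attains it. As [a] has the same size, it
   is attained at the same component of [a], and cancelling leading terms there is enough. *)
have [sb|sb] := eqVneq (hyp_size b) (size b.1).*2.
  have sa : size a.1 = size b.1.
    move: eq_size; rewrite /hyp_size; case: eqP => [_|/eqP na]; first by lia.
    by move: (ha2 na); rewrite sb /hyp_deg; lia.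
  exists (lead_coef a.1 / lead_coef b.1); apply/dec; split.
    rewrite sb ltn_double lead // -size_poly_gt0; lia.
  set c := _ / _ => nz.
  have m2 : (size (a.2 - c%:P * b.2)%R <= maxn (size a.2) (size b.2))%N.
    by apply: sz; rewrite leq_max leqnn ?orbT.
  rewrite sb; move: (size (a.2 - c%:P * b.2)%R) m2 => s; rewrite sb in ha2 hb2.
  have [za|/ha2] := eqVneq a.2 0; have [zb|/hb2] := eqVneq b.2 0.
  - by rewrite za zb mulr0 subr0 eqxx in nz.
  - by rewrite za size_poly0 /hyp_deg; lia.
  - by rewrite zb size_poly0 /hyp_deg; lia.
  - by rewrite /hyp_deg; lia.
have nb : b.2 != 0.
  by apply/eqP => zb; move: sb; rewrite /hyp_size zb eqxx maxn0 eqxx.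
have {}sb : hyp_size b = ((size b.2).*2 + n)%N.
  move: sb; rewrite /hyp_size (negPf nb); lia.
have na : a.2 != 0.
  apply/eqP => za; move: eq_size; rewrite sb /hyp_size za eqxx maxn0 /hyp_deg; lia.
have sa : size a.2 = size b.2.
  move: eq_size; rewrite sb /hyp_size (negPf na) /hyp_deg; lia.
exists (lead_coef a.2 / lead_coef b.2); apply/dec; split.
  set c := _ / _; have : (size (a.1 - c%:P * b.1)%R <= maxn (size a.1) (size b.1))%N.
    by apply: sz; rewrite leq_max leqnn ?orbT.
  by move: (size (a.1 - c%:P * b.1)%R) ha1 hb1 => s; rewrite sb /hyp_deg; lia.
by rewrite sb ltn_add2r ltn_double lead.
Qed.

End HyperellipticRing.

(** * Integral closures and valuation rings *)

(** A valuation ring [V] of [K] with its maximal ideal [M], described by membership alone, without a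
    value group. *)
Record valuation_pair (K : fieldType) (V M : K -> Prop) : Prop := ValuationPair {
  val_sub : forall x, M x -> V x;
  val0 : M 0;
  val1 : V 1;
  val_non1 : ~ M 1;
  valD : forall x y, V x -> V y -> V (x + y);
  valMD : forall x y, M x -> M y -> M (x + y);
  valM : forall x y, V x -> V y -> V (x * y);
  valMM : forall x y, V x -> M y -> M (x * y);
  val_total : forall x, V x \/ M x^-1;
  val_inv : forall x, V x -> ~ M x -> V x^-1 }.

Section ValuationClosure.
Variables (C K : fieldType) (kappa : {rmorphism C -> K}) (V M B : K -> Prop).
Hypothesis VM : valuation_pair V M.
Hypothesis BV : forall x, B x -> V x.
Hypothesis residue : forall x, V x -> exists c, M (x - kappa c).
Hypothesis B0 : B 0.
Hypothesis Bconst : forall c x, B x -> B (kappa c - x).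
Hypothesis conductor : exists2 N, (0 < N)%N & forall x, M x -> B (x ^+ N).

(** A valuation ring is integrally closed, which gives one direction. Conversely, if [x] has residue
    [c], it is a root of the monic polynomial [('X - c) ^+ N - (x - c) ^+ N], whose coefficients are
    constants of [B], except for the last one, which is a constant minus an element of [B]. *)
Lemma val_integral_closure x : integral_closure B x <-> V x.
Proof.
split=> [[p [mon_p Bp /rootP px]]|Vx].
  have [->|x0] := eqVneq x 0; first exact/(val_sub VM)/(val0 VM).
  have [//|My] := val_total VM x; exfalso; apply: (val_non1 VM).
  (* Dividing the integral equation by the top power of [x] would put 1 in [M] if [x^-1] were in
     [M]. *)
  have sum0 : 1 + \sum_(i < (size p).-1) p`_i * x^-1 ^+ ((size p).-1 - i) = 0.
    rewrite -[LHS](mulfK (expf_neq0 (size p).-1 x0)) -[RHS](mul0r (x ^- (size p).-1)).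
    congr (_ / _); apply: (etrans _ px).
    rewrite (horner_coef_wide _ (leqSpred _)) big_ord_recr /= -lead_coefE.
    rewrite (monicP mon_p) mulrDl !mul1r addrC; congr (_ + _).
    rewrite mulr_suml; apply: eq_bigr => i _; rewrite -mulrA; congr (_ * _).
    rewrite -[X in _ * X = _](_ : x ^+ ((size p).-1 - i + i) = _).
      by rewrite exprD mulrA exprVn mulVf ?mul1r ?expf_neq0.
    by rewrite subnK // ltnW.
  have -> : 1 = - \sum_(i < (size p).-1) p`_i * x^-1 ^+ ((size p).-1 - i).
    by apply/eqP; rewrite -addr_eq0 sum0.
  rewrite -mulN1r; apply: (valMM VM).
    by have [//|] := val_total VM (-1); rewrite invrN1 => /(val_sub VM).
  apply: big_ind => [|y z|i _]; [exact: val0 VM|exact: (valMD VM)|].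
  apply: (valMM VM); first exact/BV.
  rewrite -(subnSK (ltn_ord i)) exprSr; apply: (valMM VM) => //.
  elim: (_ - _)%N => [|k IH]; first exact: val1 VM.
  by rewrite exprS; apply: (valM VM) => //; exact: (val_sub VM).
have [c Mxc] := residue Vx; have [N N_gt0 Bpow] := conductor.
exists (('X - (kappa c)%:P) ^+ N - ((x - kappa c) ^+ N)%:P); split.
- rewrite monicE lead_coefDl ?lead_coef_exp ?lead_coefXsubC ?expr1n //.
  by rewrite size_polyN size_exp_XsubC (leq_ltn_trans (size_polyC_leq1 _)).
- move=> i; rewrite coefB coefC.
  have [d ->] : exists d, (('X - (kappa c)%:P) ^+ N)`_i = kappa d.
    exists (('X - c%:P) ^+ N)`_i.
    by rewrite -coef_map rmorphXn rmorphB /= map_polyX map_polyC.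
  by case: eqP => _; apply: Bconst => //; exact: Bpow.
- by rewrite /root !hornerE subrr.
Qed.

Lemma val_maximal_ideal : maximal_ideal (integral_closure B) M.
Proof.
have OV := val_integral_closure; split.
- split; [by move=> x /(val_sub VM)/OV|exact: val0 VM|exact: (valMD VM)|].
  by move=> b x /OV; exact: (valMM VM).
- exact: val_non1 VM.
move=> J [JV J0 JD JM] MJ nJ1 x Jx; apply: contrapT => nMx; apply: nJ1.
have Vx := iffLR (OV x) (JV _ Jx).
have x0 : x != 0 by apply/eqP => x0; apply: nMx; rewrite x0; exact: val0 VM.
by rewrite -(mulVf x0); apply: JM => //; apply/OV/(val_inv VM).
Qed.

(** [V] is local: an element of [V] outside [M] is a unit, so a proper ideal is contained in [M]. *)
Lemma val_maximal_ideal_uniq M' :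
  maximal_ideal (integral_closure B) M' -> forall x, M' x <-> M x.
Proof.
have OV := val_integral_closure; move=> [[M'V M'0 M'D M'M] nM'1 max_M'].
have sub x : M' x -> M x.
  move=> M'x; apply: contrapT => nMx; apply: nM'1.
  have Vx := iffLR (OV x) (M'V _ M'x).
  have x0 : x != 0 by apply/eqP => x0; apply: nMx; rewrite x0; exact: val0 VM.
  by rewrite -(mulVf x0); apply: M'M => //; apply/OV/(val_inv VM).
have [idM _ _] := val_maximal_ideal.
by split; [exact: sub|apply: max_M' => //; exact: val_non1 VM].
Qed.

End ValuationClosure.

(** * The place at infinity of the field of fractions *)

Lemma fraction_exists (R : idomainType) (z : {fraction R}) :
  exists a b : R, b != 0 /\ z = a%:F / b%:F.
Proof.
elim/quotW: z => x; exists \n_x, \d_x; have d0 := denom_ratioP x; split=> //.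
have d0' : (\d_x)%:F != 0 :> {fraction R} by rewrite tofrac_eq0.
apply: (mulIf d0'); rewrite divfK //; unlock FracField.tofrac.
rewrite -[LHS]FracField.pi_mul; apply/eqmodP => /=.
by rewrite FracField.equivfE /FracField.mulf !numden_Ratio ?mulr1 ?mulf_neq0 ?oner_neq0 // mulrC.
Qed.

Section HyperellipticPlace.
Variables (C : fieldType) (h : nat).
Local Notation A := (hyp C h).
Local Notation K := {fraction A}.
Implicit Types (a b : A) (x y z : K).

Lemma hyp_size0 : hyp_size (0 : A) = 0%N.
Proof. by apply/eqP; rewrite hyp_size_eq0. Qed.

Lemma hyp_size_le_mulr a b c : c != 0 ->
  (hyp_size (a * c)%R <= hyp_size (b * c)%R)%N = (hyp_size a <= hyp_size b)%N.
Proof.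
move=> c0; have [->|a0] := eqVneq a 0; first by rewrite mul0r hyp_size0.
have c1 := hyp_size_gt1 c0; have sa := hyp_sizeM a0 c0.
have [->|b0] := eqVneq b 0.
  by rewrite mul0r hyp_size0 !leqn0 !hyp_size_eq0 mulf_eq0 (negPf c0) orbF.
have sb := hyp_sizeM b0 c0; apply/idP/idP; lia.
Qed.

Lemma hyp_size_lt_mulr a b c : c != 0 ->
  (hyp_size (a * c)%R < hyp_size (b * c)%R)%N = (hyp_size a < hyp_size b)%N.
Proof. by move=> c0; rewrite !ltnNge hyp_size_le_mulr. Qed.

(** With [hyp_maxval], the valuation ring of the place at infinity and its maximal ideal: the pole
    of the numerator is compared with that of the denominator. *)
Definition hyp_val z :=
  exists a b, [/\ b != 0, z = a%:F / b%:F & (hyp_size a <= hyp_size b)%N].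
Definition hyp_maxval z :=
  exists a b, [/\ b != 0, z = a%:F / b%:F & (hyp_size a < hyp_size b)%N].

Lemma frac_eq a b a' b' : b != 0 -> b' != 0 ->
  a%:F / b%:F = a'%:F / b'%:F :> K -> a * b' = a' * b.
Proof.
move=> b0 b'0 /eqP; rewrite eqr_div ?tofrac_eq0 // -!tofracM tofrac_eq.
by move=> /eqP.
Qed.

(** The comparison does not depend on the chosen fraction, by cross-multiplication and additivity of
    pole orders. *)
Lemma hyp_valE a b : b != 0 -> hyp_val (a%:F / b%:F) <-> (hyp_size a <= hyp_size b)%N.
Proof.
move=> b0; split=> [[a' [b' [b'0 e le]]]|]; last by exists a, b.
have ab := frac_eq b0 b'0 e.
by rewrite -(hyp_size_le_mulr _ _ b'0) ab [b * _]mulrC hyp_size_le_mulr.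
Qed.

Lemma hyp_maxvalE a b : b != 0 ->
  hyp_maxval (a%:F / b%:F) <-> (hyp_size a < hyp_size b)%N.
Proof.
move=> b0; split=> [[a' [b' [b'0 e le]]]|]; last by exists a, b.
have ab := frac_eq b0 b'0 e.
by rewrite -(hyp_size_lt_mulr _ _ b'0) ab [b * _]mulrC hyp_size_lt_mulr.
Qed.

Lemma tofrac_addf a b a' b' : b != 0 -> b' != 0 ->
  a%:F / b%:F + a'%:F / b'%:F = (a * b' + a' * b)%:F / (b * b')%:F :> K.
Proof.
by move=> b0 b'0; rewrite addf_div ?tofrac_eq0 // !(tofracM, tofracD).
Qed.

Lemma tofrac_mulf a b a' b' :
  a%:F / b%:F * (a'%:F / b'%:F) = (a * a')%:F / (b * b')%:F :> K.
Proof. by rewrite mulf_div !tofracM. Qed.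

Lemma tofrac1E : 1 = 1%:F / 1%:F :> K.
Proof. by rewrite tofrac1 divr1. Qed.

Lemma hyp_valuation_pair : valuation_pair hyp_val hyp_maxval.
Proof.
have s_gt b : b != 0 -> (0 < hyp_size b)%N by move/hyp_size_gt1/ltnW.
split.
- by move=> x [a [b [b0 -> /ltnW]]]; exists a, b.
- by exists 0, 1; rewrite oner_neq0 tofrac0 mul0r hyp_size0 s_gt ?oner_neq0.
- by rewrite tofrac1E hyp_valE ?oner_neq0.
- by rewrite tofrac1E hyp_maxvalE ?oner_neq0 // ltnn.
- move=> _ _ [a [b [b0 -> le]]] [a' [b' [b'0 -> le']]].
  rewrite tofrac_addf // hyp_valE ?mulf_neq0 // hyp_sizeD //.
    by rewrite hyp_size_le_mulr.
  by rewrite [b * _]mulrC hyp_size_le_mulr.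
- move=> _ _ [a [b [b0 -> le]]] [a' [b' [b'0 -> le']]].
  have sbb := s_gt _ (mulf_neq0 b0 b'0).
  rewrite tofrac_addf // hyp_maxvalE ?mulf_neq0 // -(prednK sbb) ltnS hyp_sizeD //.
    by rewrite -ltnS prednK // hyp_size_lt_mulr.
  by rewrite -ltnS prednK // [b * _]mulrC hyp_size_lt_mulr.
- move=> _ _ [a [b [b0 -> le]]] [a' [b' [b'0 -> le']]].
  rewrite tofrac_mulf hyp_valE ?mulf_neq0 //.
  apply: (@leq_trans (hyp_size (b * a'))).
    have [->|a'0] := eqVneq a' 0; first by rewrite !mulr0.
    by rewrite hyp_size_le_mulr.
  by rewrite ![b * _]mulrC hyp_size_le_mulr.
- move=> _ _ [a [b [b0 -> le]]] [a' [b' [b'0 -> le']]].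
  rewrite tofrac_mulf hyp_maxvalE ?mulf_neq0 //.
  apply: (@leq_ltn_trans (hyp_size (b * a'))).
    have [->|a'0] := eqVneq a' 0; first by rewrite !mulr0.
    by rewrite hyp_size_le_mulr.
  by rewrite ![b * _]mulrC hyp_size_lt_mulr.
- move=> x; have [a [b [b0 ->]]] := fraction_exists x.
  have [le|lt] := leqP (hyp_size a) (hyp_size b); first by left; apply/hyp_valE.
  right; rewrite invf_div hyp_maxvalE // -hyp_size_eq0; lia.
move=> _ [a [b [b0 -> le]]]; rewrite hyp_maxvalE // => /negP; rewrite -leqNgt => ge.
by rewrite invf_div hyp_valE // -hyp_size_eq0; have := s_gt _ b0; lia.
Qed.

Lemma hyp_val_residue x : hyp_val x -> exists c : C, hyp_maxval (x - (hyp_const h c)%:F).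
Proof.
move=> [a [b [b0 -> le]]]; have [c lt] := hyp_residue b0 le; exists c.
have -> : a%:F / b%:F - (hyp_const h c)%:F = (a - hyp_const h c * b)%:F / b%:F :> K.
  by rewrite tofracB mulrBl tofracM mulfK // tofrac_eq0.
by rewrite hyp_maxvalE.
Qed.

(** A gap of at least 1 between the two pole orders becomes a gap of at least [N] in the [N]-th
    power. *)
Lemma hyp_maxval_pow N x : (0 < N)%N -> hyp_maxval x ->
  exists a b, [/\ b != 0, x ^+ N = a%:F / b%:F & (hyp_size a + N <= hyp_size b)%N].
Proof.
move=> N_gt0 [a [b [b0 -> lt]]]; have [->|a0] := eqVneq a 0.
  have v0 : hyp_v C h != 0 by apply/eqP => -[] /eqP; rewrite polyX_eq0.
  (* The numerator 0 has size 0, so a denominator of size at least [N] is enough; this one has size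
     [2 * N + 2]. *)
  exists 0, (hyp_v C h ^+ N); rewrite expf_neq0 // tofrac0 !mul0r expr0n.
  rewrite -[N == _]negbK -lt0n N_gt0 hyp_size0; split=> //.
  by rewrite hyp_sizeX // /hyp_size /= eqxx size_polyX maxn0; lia.
exists (a ^+ N), (b ^+ N); rewrite expf_neq0 // exprMn exprVn !tofracXn; split=> //.
rewrite !hyp_sizeX //; have := hyp_size_gt1 a0; have := hyp_size_gt1 b0.
move: (hyp_size a) (hyp_size b) lt => s t; nia.
Qed.

End HyperellipticPlace.

(** * The plane embeddings *)

Lemma mpoly_gen_ind m (R : comNzRingType) (P : {mpoly R[m]} -> Prop) :
    (forall c, P c%:MP) -> (forall i, P 'X_i) ->
    (forall p q, P p -> P q -> P (p + q)) -> (forall p q, P p -> P q -> P (p * q)) ->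
  forall p, P p.
Proof.
move=> PC PX PD PM p; rewrite [p]mpolyE; apply: big_ind => [||mm _].
- by rewrite -mpolyC0; exact: PC.
- exact: PD.
rewrite -mul_mpolyC; apply: (PM) => //; rewrite mpolyXE_id.
apply: big_ind => [||i _]; [by rewrite -mpolyC1; exact: PC|exact: PM|].
by elim: (mm i) => [|k IH]; [rewrite expr0 -mpolyC1|rewrite exprS; apply: (PM)].
Qed.

Lemma poly_fun_inj (F : numFieldType) (p q : {poly F}) :
  (forall t, p.[t] = q.[t]) -> p = q.
Proof.
move=> pq; apply/eqP; rewrite -subr_eq0; apply/negPn/negP => nz.
pose s := [seq i%:R | i <- iota 0 (size (p - q))] : seq F.
have us : uniq s by rewrite map_inj_uniq ?iota_uniq // => i j /eqP; rewrite eqr_nat => /eqP.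
have root_s : all (root (p - q)) s by apply/allP => t _; rewrite /root hornerD hornerN pq subrr.
by have := max_poly_roots nz root_s us; rewrite size_map size_iota ltnn.
Qed.

(** * The universal property of a principal quotient *)

Section PrincipalQuotientLift.
Variables (F : fieldType) (A : comAlgType F) (a : A).

Lemma quot_class_surj (x : principal_quot a) : exists g, x = quot_class a g.
Proof. by exists (repr x); rewrite quot_class_repr. Qed.

Lemma quot_class_eq0 g : quot_class a g = 0 <-> exists q, g = q * a.
Proof.
rewrite -(rmorph0 (quot_class a)); split=> [/quot_classP|[q ->]].
  by rewrite subr0 => /principalP.
by apply/quot_classP; rewrite subr0; apply/principalP; exists q.
Qed.

Lemma quot_lift (S : pzRingType) (E : {rmorphism A -> S}) : E a = 0 ->
  exists phi : {rmorphism principal_quot a -> S},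
    forall g, phi (quot_class a g) = E g.
Proof.
move=> Ea0; pose phi (x : principal_quot a) := E (repr x).
have phiE g : phi (quot_class a g) = E g.
  have /quot_classP/principalP[q eq_q] := quot_class_repr (quot_class a g).
  by apply/eqP; rewrite -subr_eq0 -rmorphB eq_q rmorphM Ea0 mulr0.
have phiB : zmod_morphism phi.
  move=> x y; have [g ->] := quot_class_surj x; have [g' ->] := quot_class_surj y.
  by rewrite -rmorphB !phiE rmorphB.
have phiM : monoid_morphism phi.
  split=> [|x y]; first by rewrite -(rmorph1 (quot_class a)) phiE rmorph1.
  have [g ->] := quot_class_surj x; have [g' ->] := quot_class_surj y.
  by rewrite -rmorphM !phiE rmorphM.
pose phi' : {rmorphism principal_quot a -> S} :=
  HB.pack phi (GRing.isZmodMorphism.Build _ _ phi phiB)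
    (GRing.isMonoidMorphism.Build _ _ phi phiM).
by exists phi'.
Qed.

End PrincipalQuotientLift.

(** The polynomial that restricts to [v] on the curve: with [x = u] and [y = v^d], it becomes
    [u^2 + v^n + 1]. *)
Definition emb_root (C : fieldType) (e : nat) : {mpoly C[2]} := 'X_ord0 ^+ 2 + 'X_ord_max ^+ e + 1.

Definition emb_curve (C : fieldType) (d e : nat) : {mpoly C[2]} :=
  'X_ord_max - emb_root C e ^+ d.

Lemma emb_curve_eval (C : fieldType) d e (v : 'I_2 -> C) :
  (emb_curve C d e).@[v] = v ord_max - (v ord0 ^+ 2 + v ord_max ^+ e + 1) ^+ d.
Proof.
by rewrite mevalB mevalXU rmorphXn /emb_root /= !mevalD !rmorphXn meval1 /= !mevalXU.
Qed.

Section Embedding.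
Variables (C : numClosedFieldType) (h d e : nat).
Local Notation n := (hyp_deg h).
Hypothesis dvd_de : (d * e)%N = n.
Local Notation A := (hyp C h).
Local Notation K := {fraction A}.
Local Notation f := (emb_curve C d e).
Local Notation W := (emb_root C e).
Local Notation Q := (principal_quot f).

Definition emb : {mpoly C[2]} -> A :=
  mmap (hyp_const h) (fun i => if i == ord0 then hyp_u C h else hyp_v C h ^+ d).
HB.instance Definition _ := GRing.RMorphism.on emb.

Lemma embC c : emb c%:MP = hyp_const h c.
Proof. exact: mmapC. Qed.
Lemma embx : emb 'X_ord0 = hyp_u C h.
Proof. by rewrite /emb mmapX mmap1U. Qed.
Lemma emby : emb 'X_ord_max = hyp_v C h ^+ d.
Proof. by rewrite /emb mmapX mmap1U. Qed.

Lemma emb_rootE : emb W = hyp_v C h.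
Proof.
rewrite !rmorphD !rmorphXn rmorph1 /= embx emby hyp_u2 -exprM dvd_de.
rewrite -rmorphXn -rmorphD -(rmorph1 (hyp_base h)) -rmorphD /hyp_v /hyp_poly.
by congr hyp_base; ring.
Qed.

Lemma emb_curve0 : emb f = 0.
Proof. by rewrite rmorphB rmorphXn /= emby emb_rootE subrr. Qed.

(** A section of [emb], with [W] put for [v] and [x] for [u]. It is additive, and becomes
    multiplicative modulo [f]. *)
Definition emb_sec (a : A) : {mpoly C[2]} :=
  horner_alg W a.1 + horner_alg W a.2 * 'X_ord0.

Lemma emb_horner p : emb (horner_alg W p) = hyp_base h p.
Proof.
elim/poly_ind: p => [|p c IH]; first by rewrite !rmorph0.
rewrite !rmorphD !rmorphM /= IH horner_algX horner_algC emb_rootE.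
by rewrite -mul_mpolyC mulr1 embC.
Qed.

Lemma emb_secK a : emb (emb_sec a) = a.
Proof.
case: a => a0 a1; rewrite rmorphD rmorphM /= !emb_horner embx hypM.
by rewrite /hyp_base; congr (_, _) => /=; ring.
Qed.

Fact emb_sec_zmod : zmod_morphism emb_sec.
Proof. by move=> a b; rewrite /emb_sec !rmorphB /=; ring. Qed.
HB.instance Definition _ := GRing.isZmodMorphism.Build A {mpoly C[2]} emb_sec emb_sec_zmod.

(** The defining relation of [A] survives the section: modulo [f], [y] equals [W ^+ d], so [W ^+ n]
    equals [y ^+ e]. *)
Lemma quot_emb_poly : quot_class f (horner_alg W (hyp_poly C h)) = quot_class f ('X_ord0 ^+ 2).
Proof.
have -> : horner_alg W (hyp_poly C h) = W - W ^+ n - 1.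
  by rewrite /hyp_poly !rmorphB !rmorphXn rmorph1 /= !horner_algX.
apply/eqP; rewrite -subr_eq0 -rmorphB.
have -> : W - W ^+ n - 1 - 'X_ord0 ^+ 2 = 'X_ord_max ^+ e - (W ^+ d) ^+ e :> {mpoly C[2]}.
  by rewrite -exprM dvd_de /emb_root; ring.
have /eqP : quot_class f ('X_ord_max - W ^+ d) = 0.
  by apply/quot_class_eq0; exists 1; rewrite mul1r.
by rewrite !rmorphB !rmorphXn subr_eq0 => /eqP ->; rewrite subrr.
Qed.

Lemma quot_emb_secM a b : quot_class f (emb_sec (a * b)) =
  quot_class f (emb_sec a) * quot_class f (emb_sec b).
Proof.
have /quot_classP/principalP[q eq_q] := quot_emb_poly.
rewrite -[RHS]rmorphM; apply/quot_classP/principalP.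
exists (horner_alg W a.2 * horner_alg W b.2 * q).
rewrite -[RHS]mulrA -[q * _]eq_q hypM /emb_sec /= !(rmorphD, rmorphM) /=.
set r := horner_alg W (hyp_poly C h); ring.
Qed.

(** By multiplicativity, it suffices to check generators; only [y] is affected, being sent to
    [W ^+ d], which is congruent to it modulo [f]. *)
Lemma quot_emb_secK g : quot_class f (emb_sec (emb g)) = quot_class f g.
Proof.
elim/mpoly_gen_ind: g => [c|i|p q IHp IHq|p q IHp IHq].
- by rewrite embC /emb_sec /= horner_algC rmorph0 mul0r addr0 -mul_mpolyC mulr1.
- case: (unliftP ord0 i) => [j|] ->; last first.
    by rewrite embx /emb_sec /= rmorph0 add0r rmorph1 mul1r.
  have -> : lift ord0 j = ord_max by apply/val_inj; rewrite /= ord1.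
  rewrite emby -rmorphXn /emb_sec /= rmorph0 mul0r addr0 rmorphXn /= horner_algX.
  by apply/esym/quot_classP/principalP; exists 1; rewrite mul1r.
- by rewrite (rmorphD emb) (raddfD emb_sec) [LHS]raddfD [RHS]raddfD; congr (_ + _).
- by rewrite (rmorphM emb) [RHS]rmorphM quot_emb_secM; congr (_ * _).
Qed.

Lemma emb_eq0 g : emb g = 0 <-> exists q, g = q * f.
Proof.
split=> [g0|[q ->]]; last by rewrite rmorphM /= emb_curve0 mulr0.
by apply/quot_class_eq0; rewrite -quot_emb_secK g0 !raddf0.
Qed.

Lemma emb_curve_neq0 : f != 0.
Proof.
apply/eqP => /(congr1 (fun p => p.@[fun=> 0])).
rewrite meval0 emb_curve_eval !expr0n; have [e0|_] := eqVneq e 0%N; first by have := dvd_de; rewrite e0 muln0.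
by rewrite /= !add0r expr1n => /eqP; rewrite oppr_eq0 oner_eq0.
Qed.

(** [f] generates the kernel of a morphism to a domain. A factor in this kernel is a multiple
    [r * f], and cancelling [f] makes the other factor invertible. *)
Lemma emb_curve_irreducible : irreducible_elt f.
Proof.
split; first exact: emb_curve_neq0.
  apply/negP => /unitrP[g [gf _]]; have /eqP := congr1 emb gf.
  by rewrite rmorphM rmorph1 /= emb_curve0 mulr0 eq_sym oner_eq0.
move=> p q fpq; have /eqP := emb_curve0; rewrite fpq rmorphM mulf_eq0 /=.
have aux (p' q' : {mpoly C[2]}) : f = p' * q' -> emb p' == 0 -> q' \is a GRing.unit.
  move=> fpq' /eqP/emb_eq0[r pr]; apply/unitrPr; exists r.
  by apply: (mulIf emb_curve_neq0); rewrite mul1r [in RHS]fpq' pr; ring.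
case/orP => e0; [right; exact: aux e0|left; apply: aux e0].
by rewrite mulrC.
Qed.

Lemma emb_lift : exists phi : {rmorphism Q -> A},
  injective phi /\ forall g, phi (quot_class f g) = emb g.
Proof.
have [phi phiE] := quot_lift emb_curve0; exists phi; split=> // x y.
have [g ->] := quot_class_surj x; have [g' ->] := quot_class_surj y.
rewrite !phiE => eq_e; apply/eqP; rewrite -subr_eq0 -rmorphB; apply/eqP.
by apply/quot_class_eq0/emb_eq0; rewrite rmorphB eq_e subrr.
Qed.

Lemma emb_sec_lift : exists beta : {rmorphism A -> Q},
  forall a, beta a = quot_class f (emb_sec a).
Proof.
pose beta a := quot_class f (emb_sec a).
have betaB : zmod_morphism beta by move=> x y; rewrite /beta !raddfB.
have betaM : monoid_morphism beta.
  split=> [|x y]; last exact: quot_emb_secM.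
  rewrite /beta; congr (quot_class f _).
  by rewrite /emb_sec /= rmorph0 mul0r addr0 rmorph1.
pose beta' : {rmorphism A -> Q} :=
  HB.pack beta (GRing.isZmodMorphism.Build _ _ beta betaB)
    (GRing.isMonoidMorphism.Build _ _ beta betaM).
by exists beta'.
Qed.

(** The solutions [(u0, v0)] of the hyperelliptic equation parametrize points [(u0, v0 ^+ d)] of the
    plane curve, where [g] takes the value of [emb g] at [(u0, v0)]. *)
Lemma hyp_eval (u0 v0 : C) (g : {mpoly C[2]}) : u0 ^+ 2 = (hyp_poly C h).[v0] ->
  g.@[fun i => if i == ord0 then u0 else v0 ^+ d] = (emb g).1.[v0] + (emb g).2.[v0] * u0.
Proof.
move=> u0v0; elim/mpoly_gen_ind: g => [c|i|p q IHp IHq|p q IHp IHq].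
- by rewrite mevalC embC /= hornerC horner0 mul0r addr0.
- rewrite mevalXU; case: (unliftP ord0 i) => [j|] ->; last first.
    by rewrite embx /hyp_u /= horner0 add0r hornerC mul1r.
  have -> : lift ord0 j = ord_max by apply/val_inj; rewrite /= ord1.
  by rewrite emby -rmorphXn /= horner_exp hornerX horner0 mul0r addr0.
- by rewrite mevalD rmorphD /= !hornerD IHp IHq; ring.
- rewrite mevalM (rmorphM emb) hypM IHp IHq /= !hornerD !hornerM -u0v0; ring.
Qed.

(** Over each [v0], both square roots [u0] and [- u0] give points of the curve. The norm of [emb g]
    at [v0] is the product of the two values of [g], so it vanishes identically, and [emb g] is
    zero. *)
Lemma emb_nullstellensatz g :
  (forall v, f.@[v] = 0 -> g.@[v] = 0) -> exists q, g = q * f.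
Proof.
move=> g0; apply/emb_eq0/eqP; rewrite -hyp_norm_eq0; apply/eqP.
have norm0 (v0 : C) : root (hyp_norm (emb g)) v0.
  pose u0 := sqrtC (hyp_poly C h).[v0]; have u0v0 : u0 ^+ 2 = (hyp_poly C h).[v0] := sqrtCK _.
  have f0 w : w ^+ 2 = (hyp_poly C h).[v0] -> (emb g).1.[v0] + (emb g).2.[v0] * w = 0.
    move=> wv; rewrite -hyp_eval //; apply: g0.
    by rewrite (hyp_eval _ wv) emb_curve0 /= !horner0 mul0r addr0.
  rewrite /root /hyp_norm hornerD hornerN !horner_exp hornerM horner_exp -u0v0.
  have h1 := f0 _ u0v0; have h2 := f0 (- u0); rewrite sqrrN u0v0 in h2.
  have -> : (emb g).1.[v0] ^+ 2 - u0 ^+ 2 * (emb g).2.[v0] ^+ 2 =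
    ((emb g).1.[v0] + (emb g).2.[v0] * u0) * ((emb g).1.[v0] + (emb g).2.[v0] * - u0) by ring.
  by rewrite h1 mul0r.
by apply: poly_fun_inj => v0; rewrite horner0; exact/rootP.
Qed.

End Embedding.

(** Both coordinate rings are isomorphic to [hyp C h]: [emb] for one curve is followed by the
    section for the other. Linearity holds because constants are fixed. *)
Lemma emb_isomorphic (C : numClosedFieldType) (h d e d' e' : nat) :
  (d * e)%N = hyp_deg h -> (d' * e')%N = hyp_deg h ->
  isomorphic_curves (emb_curve C d e) (emb_curve C d' e').
Proof.
move=> de de'.
pose f := emb_curve C d e; pose f' := emb_curve C d' e'.
have lift d1 e1 d2 e2 : (d1 * e1)%N = hyp_deg h -> (d2 * e2)%N = hyp_deg h ->
    exists phi : {rmorphism principal_quot (emb_curve C d1 e1) -> principal_quot (emb_curve C d2 e2)},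
    forall g, phi (quot_class _ g) = quot_class _ (emb_sec e2 (emb h d1 g)).
  move=> de1 de2; have [phi [_ phiE]] := emb_lift C de1.
  have [beta betaE] := emb_sec_lift C de2.
  by exists (beta \o phi) => g /=; rewrite phiE betaE.
have [phi phiE] := lift _ _ _ _ de de'; have [psi psiE] := lift _ _ _ _ de' de.
exists phi; split.
  move=> c x; have [g ->] := quot_class_surj x.
  have -> : c *: quot_class f g = quot_class f (c%:MP * g).
    by rewrite mul_mpolyC; exact/esym/(quot_class_scalable f c g).
  have -> : c *: phi (quot_class f g) = quot_class f' c%:MP * phi (quot_class f g).
    have [g' ->] := quot_class_surj (phi (quot_class f g)).
    by rewrite -rmorphM mul_mpolyC; exact/esym/(quot_class_scalable f' c g').
  rewrite !rmorphM phiE; congr (quot_class _ _ * _).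
  by rewrite embC /emb_sec /= horner_algC rmorph0 mul0r addr0 -mul_mpolyC mulr1.
exists psi => x; have [g ->] := quot_class_surj x.
  by rewrite phiE psiE (emb_secK de') (quot_emb_secK de).
by rewrite psiE phiE (emb_secK de) (quot_emb_secK de').
Qed.

(** * One place at infinity *)

Section PlaceAtInfinity.
Variables (C : numClosedFieldType) (h d e : nat).
Local Notation n := (hyp_deg h).
Hypothesis dvd_de : (d * e)%N = n.
Hypothesis e_gt2 : (2 < e)%N.
Local Notation A := (hyp C h).
Local Notation K := {fraction A}.
Local Notation f := (emb_curve C d e).
Local Notation Q := (principal_quot f).

Local Notation i0 := (lift ord_max (ord0 : 'I_2) : 'I_3).
Local Notation i1 := (lift ord_max (ord_max : 'I_2) : 'I_3).
Local Notation i2 := (ord_max : 'I_3).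

Definition res : {mpoly C[3]} -> A := emb h d \o @dehomog C.
Fact res_zmod : zmod_morphism res.
Proof. by move=> G H; rewrite /res /= /dehomog !rmorphB. Qed.
Fact res_monoid : monoid_morphism res.
Proof. by split=> [|G H]; rewrite /res /= /dehomog ?rmorph1 ?rmorphM. Qed.
HB.instance Definition _ := GRing.isZmodMorphism.Build {mpoly C[3]} A res res_zmod.
HB.instance Definition _ := GRing.isMonoidMorphism.Build {mpoly C[3]} A res res_monoid.

Lemma resC c : res c%:MP = hyp_const h c.
Proof. by rewrite /res /= /dehomog comp_mpolyC embC. Qed.
Lemma dehomogX i : dehomog 'X_i = if unlift ord_max i is Some j then 'X_j else 1 :> {mpoly C[2]}.
Proof. by rewrite /dehomog comp_mpolyXU -tnth_nth tnth_mktuple. Qed.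
Lemma res0 : res 'X_i0 = hyp_u C h.
Proof. by rewrite /res /= dehomogX liftK embx. Qed.
Lemma res1 : res 'X_i1 = hyp_v C h ^+ d.
Proof. by rewrite /res /= dehomogX liftK emby. Qed.
Lemma res2 : res 'X_i2 = 1.
Proof. by rewrite /res /= dehomogX unlift_none rmorph1. Qed.

Lemma dehomog_eval (G : {mpoly C[3]}) v : (dehomog G).@[v] = G.@[proj_of_affine v].
Proof.
rewrite /dehomog comp_mpoly_meval; apply: meval_eq => i.
by rewrite tnth_mktuple /proj_of_affine; case: unlift => [j|]; rewrite ?mevalXU ?meval1.
Qed.

Lemma ord3P (P : 'I_3 -> Prop) : P i0 -> P i1 -> P i2 -> forall i, P i.
Proof.
move=> P0 P1 P2 i; case: (unliftP ord_max i) => [j|] -> //.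
case: (unliftP ord_max j) => [k|] -> //.
by have -> : lift ord_max k = ord0 by apply/val_inj; rewrite /= ord1.
Qed.

Lemma homogX i : ('X_i : {mpoly C[3]}) \is 1.-homog.
Proof. by rewrite dhomogX /= mdeg1. Qed.

Lemma homogC c : (c%:MP : {mpoly C[3]}) \is 0.-homog.
Proof. by rewrite -[c%:MP]mulr1 mul_mpolyC dhomogZ // dhomog1. Qed.

(** The elements of [A] that are restrictions of forms of degree [D]. They grow with [D], because
    the last coordinate restricts to 1. *)
Definition form (D : nat) (a : A) := exists2 G, G \is D.-homog & res G = a.

Lemma formC c : form 0 (hyp_const h c).
Proof. by exists c%:MP; rewrite ?homogC ?resC. Qed.
Lemma formD D a b : form D a -> form D b -> form D (a + b).
Proof. by move=> [G Gd <-] [H Hd <-]; exists (G + H); rewrite ?dhomogD ?rmorphD. Qed.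
Lemma formM D E a b : form D a -> form E b -> form (D + E) (a * b).
Proof. by move=> [G Gd <-] [H Hd <-]; exists (G * H); rewrite ?dhomogM ?rmorphM. Qed.
Lemma formX D a k : form D a -> form (D * k) (a ^+ k).
Proof. by move=> [G Gd <-]; exists (G ^+ k); rewrite ?dhomogMn ?rmorphXn. Qed.
Lemma form_leq D E a : (D <= E)%N -> form D a -> form E a.
Proof.
move=> DE fa; rewrite -(subnKC DE) -[a]mulr1 -(expr1n _ (E - D)).
apply: formM => //; rewrite -[X in form X _]mul1n; apply: formX.
by exists 'X_i2; rewrite ?homogX ?res2.
Qed.
Lemma form_u : form 1 (hyp_u C h).
Proof. by exists 'X_i0; rewrite ?homogX ?res0. Qed.

(** On the curve [v] is [x^2 + y^e + 1], of degree [e] in the plane coordinates. *)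
Lemma form_v : form e (hyp_v C h).
Proof.
have -> : hyp_v C h = hyp_u C h ^+ 2 + (hyp_v C h ^+ d) ^+ e + 1.
  by rewrite -[LHS](emb_rootE C dvd_de) !rmorphD !rmorphXn rmorph1 /= embx emby.
have f1 : form e 1 by apply: (form_leq (leq0n e)); rewrite -(rmorph1 (hyp_const h)); exact: formC.
apply: formD => //; apply: formD.
  by apply: form_leq (formX 2 form_u); rewrite mul1n ltnW.
by rewrite -[X in form X _]mul1n; apply: formX; exists 'X_i1; rewrite ?homogX ?res1.
Qed.

Lemma form_base m (p : {poly C}) : (size p <= m.+1)%N -> form (e * m) (hyp_base h p).
Proof.
move=> sp; rewrite -(coefK p) poly_def rmorph_sum /=; apply: big_ind.
- by apply: (form_leq (leq0n _)); rewrite -(rmorph0 (hyp_const h)); exact: formC.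
- by move=> *; exact: formD.
move=> i _; rewrite -mul_polyC rmorphM rmorphXn /=.
apply: (@form_leq (0 + e * i)); last by apply: formM (formC _) (formX _ form_v).
by rewrite add0n leq_mul2l -ltnS (leq_trans (ltn_ord i) sp) orbT.
Qed.

(* Expansion in base [rho]: since [u ^ 2 = rho(v)], the degree of the form is
   only twice the number of digits, up to an additive constant. *)
Lemma form_base_expansion k (p : {poly C}) :
  (size p <= n * k + n)%N -> form (2 * k + e * n) (hyp_base h p).
Proof.
elim: k p => [|k IH] p sp.
  by rewrite !muln0 !add0n in sp *; apply: form_base; exact: leqW.
have rho0 := hyp_poly_neq0 C h; have srho := size_hyp_poly C h.
rewrite (divp_eq p (hyp_poly C h)) rmorphD rmorphM /= -hyp_u2; apply: formD.
  have -> : (2 * k.+1 + e * n = 2 * k + e * n + 1 * 2)%N by lia.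
  apply: formM (formX 2 form_u); apply: IH.
  by rewrite size_divp // srho succnK leq_subLR addnA -mulnS.
apply: (@form_leq (e * n)); first by rewrite leq_addl.
by apply: form_base; rewrite ltnW // -srho ltn_modp.
Qed.

(** * The local ring at the point at infinity *)

Section Point.
Variable P : 'I_3 -> C.
Hypotheses (P0 : P i0 != 0) (P1 : P i1 = 0) (P2 : P i2 = 0).

(** Only the monomial ['X_i0 ^+ D] is nonzero at [P], and it restricts to [u^D], of pole order
    [D * n]. All others restrict to smaller poles: [y = v^d] has pole order [2 * d], less than
    [n = d * e] as [2 < e], and the last coordinate has none. So the leading coefficient at infinity
    reads off the value at [P]. *)
Lemma res_lead D G : G \is D.-homog -> exists c r,
  [/\ res G = hyp_const h c * hyp_u C h ^+ D + r, (hyp_size r < D * n + 2)%N &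
      G.@[P] = c * P i0 ^+ D].
Proof.
move=> homG.
pose good G := exists c r, [/\ res G = hyp_const h c * hyp_u C h ^+ D + r,
  (hyp_size r < D * n + 2)%N & G.@[P] = c * P i0 ^+ D].
suff mono m : mdeg m = D -> good 'X_[m].
  rewrite -/(good G) [G]mpolyE big_seq; apply: big_ind => [||m mG].
  - by exists 0, 0; rewrite !rmorph0 !mul0r addr0 hyp_size0 addn2.
  - move=> G1 G2 [c1 [r1 [e1 s1 p1]]] [c2 [r2 [e2 s2 p2]]].
    exists (c1 + c2), (r1 + r2); split.
    + by rewrite !rmorphD /= e1 e2; ring.
    + by rewrite addn2 ltnS in s1 s2 *; exact: hyp_sizeD.
    + by rewrite mevalD p1 p2 mulrDl.
  have [c [r [e1 s1 p1]]] := mono m (dhomogP _ _ _ homG m mG).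
  exists (G@_m * c), (hyp_const h G@_m * r); split.
  + by rewrite -mul_mpolyC rmorphM /= resC e1 rmorphM; ring.
  + apply: leq_ltn_trans s1; have [->|r0] := eqVneq r 0; first by rewrite mulr0.
    have [->|g0] := eqVneq (hyp_const h G@_m) 0; first by rewrite mul0r hyp_size0.
    by have := hyp_sizeM g0 r0; have := hyp_size_const h G@_m; lia.
  + by rewrite mevalZ p1 mulrA.
have e0 : i0 = ord0 by apply/val_inj.
have e1 : i1 = lift ord0 ord0 by apply/val_inj.
have e2 : i2 = lift ord0 (lift ord0 ord0) by apply/val_inj.
move=> degm; have mE : 'X_[m] = 'X_i0 ^+ m i0 * 'X_i1 ^+ m i1 * 'X_i2 ^+ m i2 :> {mpoly C[3]}.
  by rewrite mpolyXE_id 3!big_ord_recl big_ord0 mulr1 mulrA e0 e1 e2.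
have degE : (m i0 + m i1 + m i2)%N = D.
  by rewrite -degm mdegE 3!big_ord_recl big_ord0 addn0 addnA e0 e1 e2.
rewrite /good mE !rmorphM !rmorphXn /= res0 res1 res2 expr1n mulr1 !mevalXU P1 P2.
have [/andP[/eqP m1 /eqP m2]|m12] := boolP ((m i1 == 0%N) && (m i2 == 0%N)).
  exists 1, 0; rewrite m1 m2 !expr0 !mulr1 addr0 rmorph1 !mul1r hyp_size0 addn2.
  by split=> //; rewrite -degE m1 m2 !addn0.
exists 0, (hyp_u C h ^+ m i0 * (hyp_v C h ^+ d) ^+ m i1); split.
- by rewrite rmorph0 mul0r add0r.
- have u0 : hyp_u C h != 0 by apply/eqP => -[/eqP]; rewrite oner_eq0.
  have v0 : hyp_v C h != 0 by apply/eqP => -[/eqP]; rewrite polyX_eq0.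
  have := hyp_sizeM (expf_neq0 (m i0) u0) (expf_neq0 (m i1) (expf_neq0 d v0)).
  rewrite !hyp_sizeX ?expf_neq0 //.
  have -> : hyp_size (hyp_u C h) = n.+2.
    by rewrite /hyp_size /= oner_eq0 size_poly0 size_poly1 max0n.
  have -> : hyp_size (hyp_v C h) = 4 by rewrite /hyp_size /= eqxx size_polyX maxn0.
  have d2 : (2 * d < n)%N.
    rewrite -dvd_de; have : (0 < n)%N by []. 
    rewrite -dvd_de; nia.
  move: (hyp_size _) => s; rewrite -degE !mulnDl.
  have : ((0 < m i1) || (0 < m i2))%N by rewrite !lt0n -negb_and.
  move: (m i0) (m i1) (m i2) n d2 => k0 k1 k2 n' d2; nia.
rewrite mul0r; move: m12; rewrite negb_and => /orP[] /negPf m0.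
  by rewrite [0 ^+ m i1]expr0n m0 mulr0 mul0r.
by rewrite [0 ^+ m i2]expr0n m0 mulr0.
Qed.

Lemma hyp_size_uX D : hyp_size (hyp_u C h ^+ D) = (D * n + 2)%N.
Proof.
have u_size : hyp_size (hyp_u C h) = n.+2.
  by rewrite /hyp_size /= oner_eq0 size_poly0 size_poly1 max0n.
by rewrite hyp_sizeX ?u_size ?subn2 // -hyp_size_eq0 u_size.
Qed.

Lemma res_size_le D G : G \is D.-homog -> (hyp_size (res G) <= D * n + 2)%N.
Proof.
move=> homG; have [c [r [-> sr _]]] := res_lead homG.
apply: hyp_sizeD (ltnW sr); have [->|c0] := eqVneq (hyp_const h c) 0.
  by rewrite mul0r hyp_size0.
have u0 : hyp_u C h ^+ D != 0 by rewrite -hyp_size_eq0 hyp_size_uX addn2.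
by have := hyp_sizeM c0 u0; have := hyp_size_const h c; rewrite hyp_size_uX; lia.
Qed.

Lemma res_size D G : G \is D.-homog -> G.@[P] != 0 ->
  hyp_size (res G) = (D * n + 2)%N.
Proof.
move=> homG GP; apply/eqP; rewrite eqn_leq res_size_le //=.
have [c [r [resG sr GPE]]] := res_lead homG.
have c0 : c != 0 by apply: contraNneq GP => c0; rewrite GPE c0 mul0r.
(* A smaller restriction would make [u^D] a constant multiple of a difference of elements of smaller
   size. *)
rewrite leqNgt; apply/negP => lt; have : (hyp_size (hyp_u C h ^+ D)%R < D * n + 2)%N.
  have -> : hyp_u C h ^+ D = hyp_const h c^-1 * (res G - r).
    by rewrite resG addrK mulrA -rmorphM mulVf // rmorph1 mul1r.
  have : (hyp_size (res G - r)%R < D * n + 2)%N.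
    by rewrite addn2 !ltnS in lt sr *; apply: hyp_sizeD; rewrite ?hyp_sizeN.
  have [->|s0] := eqVneq (res G - r) 0; first by rewrite mulr0.
  have [->|g0] := eqVneq (hyp_const h c^-1) 0; first by rewrite mul0r hyp_size0 addn2.
  by have := hyp_sizeM g0 s0; have := hyp_size_const h c^-1; lia.
by rewrite hyp_size_uX ltnn.
Qed.

(** It suffices to treat a factor ['X - z]. It divides [rho - rho(z)], and this is the restriction
    of ['X_i0 ^+ 2 - rho(z) * 'X_i2 ^+ 2], which is nonzero at [P]. *)
Lemma den_poly (p : {poly C}) : p != 0 -> exists q r H,
  [/\ H \is (2 * r).-homog, H.@[P] != 0 & res H = hyp_base h (q * p)].
Proof.
move=> p0; have [s ps] := closed_field_poly_normal p.
suff [q [r [H [homH HP resH]]]] : exists q r H, [/\ H \is (2 * r).-homog, H.@[P] != 0 &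
    res H = hyp_base h (q * \prod_(z <- s) ('X - z%:P))].
  exists ((lead_coef p)^-1 *: q), r, H; split=> //; rewrite resH {2}ps.
  by rewrite -!mul_polyC; congr (hyp_base h _); rewrite mulrACA -polyCM mulVf ?lead_coef_eq0 // mul1r.
elim: s {ps} => [|z s [q [r [H [homH HP resH]]]]].
  by exists 1, 0%N, 1; rewrite muln0 dhomog1 meval1 oner_eq0 big_nil mulr1 !rmorph1.
have /factor_theorem[t rho_t] : root (hyp_poly C h - (hyp_poly C h).[z]%:P) z.
  by rewrite /root hornerD hornerN hornerC subrr.
exists (t * q), r.+1, (('X_i0 ^+ 2 - (hyp_poly C h).[z]%:MP * 'X_i2 ^+ 2) * H); split.
- have homog2 i : ('X_i ^+ 2 : {mpoly C[3]}) \is 2.-homog := dhomogMn 2 (homogX i).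
  rewrite mulnS; apply: dhomogM => //; apply: rpredB; first exact: homog2.
  exact: dhomogM (homogC _) (homog2 _).
- rewrite mevalM mulf_neq0 // mevalB !(rmorphXn, rmorphM) /= mevalC !mevalXU P2.
  by rewrite expr0n mulr0 subr0 expf_neq0.
rewrite rmorphM /= resH rmorphB !(rmorphXn, rmorphM) /= res0 res2 expr1n mulr1 resC hyp_u2.
by rewrite -rmorphB /= rho_t big_cons !rmorphM /=; ring.
Qed.

Variable iota : {rmorphism Q -> K}.
Hypothesis iotaE : forall g, iota (quot_class f g) = (emb h d g)%:F.

Lemma restrict_formE G : restrict_form iota G = (res G)%:F.
Proof. exact: iotaE. Qed.

Lemma den_neq0 D H : H \is D.-homog -> H.@[P] != 0 -> res H != 0.
Proof. by move=> homH HP; rewrite -hyp_size_eq0 (res_size homH HP) addn2. Qed.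

Lemma local_ring_val x : local_ring iota P x -> hyp_val x.
Proof.
move=> [D [G [H [homG homH HP ->]]]]; rewrite !restrict_formE.
apply/hyp_valE; first exact: den_neq0 homH HP.
by apply: leq_trans (res_size_le homG) _; rewrite (res_size homH HP).
Qed.

(** Multiplying by the conjugate of [b], and then by a cofactor, turns the denominator into the
    restriction of a form [H] of degree [2 * r] that is nonzero at [P]. The numerator must then be
    the restriction of a form of the same degree. One degree is worth [n] in pole order: the
    expansion in base [rho] costs [e * n] extra degrees, the factor [u] one more, and the 2 is the
    offset of [hyp_size]. *)
Lemma local_ring_small a b : b != 0 ->
  (hyp_size a + (n * (e * n + 1) + 2) <= hyp_size b)%N ->
  local_ring iota P (a%:F / b%:F).
Proof.
move=> b0 small; have := b0; rewrite -hyp_norm_eq0 => /den_poly[q [r [H [homH HP resH]]]].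
have resHE : res H = (hyp_base h q * hyp_conj b) * b.
  by rewrite -mulrA hyp_conjM -rmorphM.
move: (hyp_base h q * hyp_conj b) resHE => k resHE.
have H0 := den_neq0 homH HP; have k0 : k != 0 by apply: contraNneq H0 => k0; rewrite resHE k0 mul0r.
have -> : a%:F / b%:F = (k * a)%:F / (res H)%:F :> K.
  by rewrite resHE !tofracM invfM mulrACA divff ?mul1r // tofrac_eq0.
suff [G homG resG] : form (2 * r) (k * a).
  by exists (2 * r)%N, G, H; rewrite !restrict_formE resG.
have ska : (hyp_size (k * a)%R + (n * (e * n + 1) + 2) <= 2 * r * n + 2)%N.
  rewrite -(res_size homH HP) resHE; have := hyp_sizeM k0 b0.
  have [->|a0] := eqVneq a 0; last by have := hyp_sizeM k0 a0; lia.
  rewrite mulr0 hyp_size0; have := hyp_size_gt1 k0; move: small; lia.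
case: (k * a) ska => g0 g1 ska.
have /hyp_size_leP /= [s0 s1] := leqnn (hyp_size ((g0, g1) : A)).
have gE : ((g0, g1) : A) = hyp_base h g0 + hyp_base h g1 * hyp_u C h.
  by rewrite hypM /hyp_base; congr (_, _) => /=; ring.
have r_gt0 : (0 < r)%N.
  rewrite lt0n; apply/eqP => r0; move: ska; rewrite r0 muln0 mul0n.
  by rewrite /hyp_deg; move: (hyp_size _) => s; nia.
(* One degree is kept in reserve for the factor [u] of the second component. *)
have form_small (p : {poly C}) : ((size p).*2 + n * (e * n + 1) <= 2 * r * n)%N ->
    form (2 * r - 1) (hyp_base h p).
  move=> sp; apply: (@form_leq (2 * (size p %/ n) + e * n)); last first.
    apply: form_base_expansion; rewrite mulnC -mulSnr ltnW //.
    exact: ltn_ceil.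
  have le_sp : (size p %/ n * n <= size p)%N by exact: leq_trunc_div.
  suff : (2 * (size p %/ n) + e * n + 1 <= 2 * r)%N by lia.
  rewrite -(@leq_pmul2r n) //; apply: leq_trans sp.
  by rewrite -addnA mulnDl [((e * n + 1) * n)%N]mulnC leq_add2r -mulnA mul2n leq_double.
rewrite gE; apply: formD.
  apply: (@form_leq (2 * r - 1)); [exact: leq_subr|apply: form_small].
  rewrite -(leq_add2r 2) -addnA; apply: leq_trans ska; rewrite leq_add2r.
  exact: s0.
have [->|g10] := eqVneq g1 0.
  by rewrite rmorph0 mul0r; apply: (form_leq (leq0n _)); rewrite -(rmorph0 (hyp_const h)); exact: formC.
apply: (@form_leq (2 * r - 1 + 1)); first by rewrite subnK // muln_gt0.
apply: formM form_u; apply: form_small.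
rewrite -(leq_add2r 2) -addnA; apply: leq_trans ska; rewrite leq_add2r.
exact: leq_trans (leq_addr _ _) (s1 g10).
Qed.

Lemma local_ring0 : local_ring iota P 0.
Proof.
exists 0%N, 0, 1; rewrite dhomog0 dhomog1 meval1 oner_eq0; split=> //.
by rewrite restrict_formE rmorph0 tofrac0 mul0r.
Qed.

Lemma local_ring_const c x : local_ring iota P x ->
  local_ring iota P ((hyp_const h c)%:F - x).
Proof.
move=> [D [G [H [homG homH HP ->]]]]; exists D, (c *: H - G), H; split=> //.
  by rewrite rpredB // rpredZ.
have H0 := den_neq0 homH HP.
rewrite !restrict_formE rmorphB -mul_mpolyC rmorphM /= resC tofracB tofracM.
by rewrite mulrBl mulfK // tofrac_eq0.
Qed.

(** A form that vanishes on the curve restricts to 0 by the Nullstellensatz, whereas a form nonzero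
    at [P] has a restriction of positive size. *)
Lemma in_closure : in_proj_closure f P.
Proof.
move=> D G homG Gf; apply/eqP; apply: contraT => GP.
have /eqP : res G = 0.
  apply/(emb_eq0 dvd_de)/(emb_nullstellensatz dvd_de) => v fv.
  by rewrite dehomog_eval Gf.
by rewrite -hyp_size_eq0 (res_size homG GP) addn2.
Qed.

Let kappa : {rmorphism C -> K} := @FracField.tofrac A \o hyp_const h.

Lemma normalization_at_infinity M :
  normalization_point iota P M <-> forall x, M x <-> hyp_maxval x.
Proof.
have VM := @hyp_valuation_pair C h.
have BV x : local_ring iota P x -> hyp_val x := @local_ring_val x.
have residue x : hyp_val x -> exists c, hyp_maxval (x - kappa c) := @hyp_val_residue C h x.
have conductor : exists2 N, (0 < N)%N & forall x, hyp_maxval x -> local_ring iota P (x ^+ N).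
  (* The exponent is the gap in pole orders that [local_ring_small] requires. *)
  exists (n * (e * n + 1) + 2)%N; first by rewrite addn2.
  move=> x /(hyp_maxval_pow (N := n * (e * n + 1) + 2)); rewrite addn2 => /(_ isT).
  by move=> [a [b [b0 -> small]]]; apply: local_ring_small => //; rewrite addn2.
split=> [[_ maxM]|ME].
  exact: val_maximal_ideal_uniq VM BV residue local_ring0 local_ring_const conductor _ maxM.
split; first exact: in_closure.
have -> : M = @hyp_maxval C h by apply/funext => x; apply/propext.
exact: val_maximal_ideal VM BV residue local_ring0 local_ring_const conductor.
Qed.

End Point.

Lemma closure_at_infinity P : at_infinity P -> in_proj_closure f P ->
  [/\ P i0 != 0, P i1 = 0 & P i2 = 0].
Proof.
move=> [P2 [i Pi]] clP.
(* The homogenization of [f]. On the line at infinity it reduces to [- 'X_i1 ^+ n], because [e - 2]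
   is positive. *)
pose G : {mpoly C[3]} := 'X_i1 * 'X_i2 ^+ n.-1 -
  ('X_i0 ^+ 2 * 'X_i2 ^+ (e - 2) + 'X_i1 ^+ e + 'X_i2 ^+ e) ^+ d.
have homXn j k : ('X_j ^+ k : {mpoly C[3]}) \is k.-homog.
  by have := dhomogMn k (homogX j); rewrite mul1n.
have homG : G \is n.-homog.
  apply: rpredB; first exact: (dhomogM (homogX _) (homXn _ n.-1)).
  have -> : n = (e * d)%N by rewrite mulnC.
  apply: dhomogMn.
  rewrite !rpredD //; have := dhomogM (homXn i0 2) (homXn i2 (e - 2)%N).
  by rewrite subnKC // ltnW.
have Geval v : G.@[v] = v i1 * v i2 ^+ n.-1 - (v i0 ^+ 2 * v i2 ^+ (e - 2) + v i1 ^+ e + v i2 ^+ e) ^+ d.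
  by rewrite /G mevalB !(rmorphXn, rmorphM, rmorphD) /= !mevalXU.
have P1 : P i1 = 0.
  have /eqP : G.@[P] = 0.
    apply: (clP _ _ homG) => v; rewrite emb_curve_eval Geval /proj_of_affine.
    by rewrite !liftK unlift_none !expr1n !mulr1.
  have n0 : (n.-1 == 0)%N = false by [].
  have e0 : (e - 2 == 0)%N = false by rewrite subn_eq0 leqNgt e_gt2.
  have e0' : (e == 0)%N = false by case: e e_gt2.
  rewrite Geval P2 !expr0n n0 e0 e0' !mulr0 !add0r addr0 oppr_eq0.
  by rewrite !expf_eq0 => /andP[_ /andP[_ /eqP]].
by split=> //; move: i Pi; apply: ord3P => //; rewrite ?P1 ?P2 eqxx.
Qed.

Lemma emb_one_place : one_place_at_infinity f.
Proof.
have [phi [phi_inj phiE]] := emb_lift C dvd_de.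
pose iota : {rmorphism Q -> K} := @FracField.tofrac A \o phi.
have iotaE g : iota (quot_class f g) = (emb h d g)%:F by rewrite /= phiE.
exists K, iota; split.
  split=> [x y /eqP|z]; first by rewrite /= tofrac_eq => /eqP/phi_inj.
  have [a [b [b0 ->]]] := fraction_exists z.
  exists (quot_class f (emb_sec e a)), (quot_class f (emb_sec e b)).
  rewrite !iotaE !(emb_secK dvd_de); split=> //.
  apply: contraNneq b0 => /(congr1 iota).
  by rewrite iotaE (emb_secK dvd_de) rmorph0 => /eqP; rewrite tofrac_eq0.
pose P0 (i : 'I_3) : C := (i == i0)%:R.
have [p0 p1 p2] : [/\ P0 i0 != 0, P0 i1 = 0 & P0 i2 = 0].
  by rewrite /P0 eqxx oner_eq0.
exists P0, (@hyp_maxval C h); split.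
- by split=> //; exists i0.
- by apply/normalization_at_infinity.
move=> P' M' inf' norm'; have [clP' _] := norm'.
have [p0' p1' p2'] := closure_at_infinity inf' clP'.
split; last by move=> z; apply: iff_sym; apply: (iffLR (normalization_at_infinity p0' p1' p2' iotaE M') norm').
exists (P' i0) => //; apply: ord3P; rewrite ?p1 ?p2 ?p1' ?p2' ?mulr0 //.
by rewrite /P0 eqxx mulr1.
Qed.

End PlaceAtInfinity.

(** * Critical values *)

Section PowerSums.
Variable F : fieldType.
Implicit Types s : seq F.

(* [(X - c) \sum_i c^-(i+1) X^i = (X / c)^m - 1], summed over the roots [c]. *)
Lemma neg_power_sums m s : (forall c, c \in s -> c != 0) ->
  let p := \prod_(c <- s) ('X - c%:P) in
  exists r, p^`() + p * \poly_(i < m) (\sum_(c <- s) c^-1 ^+ i.+1) = r * 'X^m.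
Proof.
elim: s => [|c s IH] s0 /=.
  exists 0; rewrite big_nil derivC mul1r mul0r add0r.
  by apply/polyP => i; rewrite coef_poly big_nil coef0 if_same.
have [|r def_r] := IH; first by move=> x xs; apply: s0; rewrite in_cons xs orbT.
rewrite big_cons.
have c0 : c != 0 by apply: s0; rewrite mem_head.
set q := \prod_(x <- s) _ in def_r *.
pose t : {poly F} := \poly_(i < m) (c^-1 ^+ i.+1).
have t_def : ('X - c%:P) * t = (c^-1 ^+ m)%:P * 'X^m - 1.
  rewrite /t poly_def; elim: (m) => [|k IHk]; first by rewrite big_ord0 mulr0 mulr1 subrr.
  rewrite big_ord_recr mulrDr IHk /= -mul_polyC.
  have -> : (c^-1 ^+ k)%:P = c%:P * (c^-1 ^+ k.+1)%:P :> {poly F}.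
    by rewrite -polyCM exprS mulrA divff // mul1r.
  by rewrite (exprS 'X); ring.
have -> : \poly_(i < m) (\sum_(x <- c :: s) x^-1 ^+ i.+1) =
    \poly_(i < m) (\sum_(x <- s) x^-1 ^+ i.+1) + t.
  by apply/polyP => i; rewrite coefD !coef_poly big_cons; case: ifP => _; rewrite ?addr0 // addrC.
exists (('X - c%:P) * r + (c^-1 ^+ m)%:P * q).
rewrite derivM derivXsubC mul1r mulrDr -mulrA [_ * q * t]mulrAC t_def.
rewrite [RHS]mulrDl -mulrA -def_r; ring.
Qed.

(* [(X - c) \sum_i c^i X^(m-1-i) = X^m - c^m], summed over the roots [c]. *)
Lemma power_sums m s :
  let p := \prod_(c <- s) ('X - c%:P) in
  exists2 r : {poly F}, 'X^m * p^`() = p * \poly_(i < m) (\sum_(c <- s) c ^+ (m.-1 - i)) + r &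
    (size r <= size s)%N.
Proof.
elim: s => [|c s [r def_r sr]] /=.
  exists 0; rewrite ?size_poly0 // big_nil derivC mul1r mulr0 addr0.
  by apply/polyP => i; rewrite coef_poly big_nil coef0 if_same.
rewrite big_cons; set q := \prod_(x <- s) _ in def_r *.
pose t : {poly F} := \poly_(i < m) (c ^+ (m.-1 - i)).
have t_def : ('X - c%:P) * t = 'X^m - (c ^+ m)%:P.
  rewrite polyC_exp -[LHS]opprK -mulNr opprB -[RHS]opprB subrXX /t poly_def.
  congr (- (_ * _)); apply: eq_bigr => i _.
  by rewrite -polyC_exp mul_polyC.
have -> : \poly_(i < m) (\sum_(x <- c :: s) x ^+ (m.-1 - i)) =
    \poly_(i < m) (\sum_(x <- s) x ^+ (m.-1 - i)) + t.
  by apply/polyP => i; rewrite coefD !coef_poly big_cons; case: ifP => _; rewrite ?addr0 // addrC.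
exists (('X - c%:P) * r + (c ^+ m)%:P * q).
  rewrite derivM derivXsubC mul1r mulrDr [X in _ + X = _]mulrCA def_r.
  set tau := \poly_(i < m) _.
  have -> : ('X - c%:P) * q * (tau + t) = ('X - c%:P) * (q * tau) + q * (('X - c%:P) * t) by ring.
  by rewrite t_def; ring.
rewrite (leq_trans (size_polyD _ _)) // geq_max; apply/andP; split.
  have [->|r0] := eqVneq r 0; first by rewrite mulr0 size_poly0.
  by rewrite size_mul ?polyXsubC_eq0 // size_XsubC.
by rewrite mul_polyC (leq_trans (size_scale_leq _ _)) // size_prod_XsubC.
Qed.

End PowerSums.

(** * The critical points on the line [x = 0] and their power sums *)

Section CriticalPolynomial.
Variables (C : numClosedFieldType) (d e n : nat).
Hypotheses (dvd_de : (d * e)%N = n) (n_gt3 : (3 < n)%N) (e_gt2 : (2 < e)%N).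
Hypothesis e_odd : odd e.

(** On the line [x = 0], which contains all critical points, [f] is ['X - crit_map]; [crit_poly] is
    the opposite of its derivative. *)
Definition crit_map : {poly C} := ('X^e + 1) ^+ d.
Definition crit_poly : {poly C} := crit_map^`() - 1.
Local Notation phi := crit_map.
Local Notation chi := crit_poly.

Let d_gt0 : (0 < d)%N.
Proof. by rewrite lt0n; apply/eqP => d0; move: n_gt3; rewrite -dvd_de d0. Qed.
Let e_gt0 : (0 < e)%N.
Proof. exact: leq_trans e_gt2. Qed.
Let nC : n%:R != 0 :> C.
Proof. by rewrite pnatr_eq0 -lt0n; apply: leq_trans n_gt3. Qed.

Lemma coef_crit_map i :
  phi`_i = if (e %| i)%N then 'C(d, i %/ e)%:R else 0.
Proof.
have -> : phi = (('X + 1) ^+ d) \Po 'X^e.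
  by rewrite rmorphXn rmorphD rmorph1 /= comp_polyX.
rewrite coef_comp_poly_Xn //; case: ifP => // _.
have -> : ('X + 1) ^+ d = \poly_(j < d.+1) 'C(d, j)%:R :> {poly C}.
  rewrite addrC exprDn poly_def; apply: eq_bigr => j _.
  by rewrite expr1n mul1r scaler_nat.
by rewrite coef_poly; case: ltnP => // lt; rewrite bin_small.
Qed.

Lemma coef_crit_poly i : chi`_i =
  (if (e %| i.+1)%N then ('C(d, i.+1 %/ e) * i.+1)%:R else 0) - (i == 0%N)%:R.
Proof.
rewrite coefB coef1 coef_deriv coef_crit_map; case: ifP => _; last by rewrite mul0rn.
by rewrite -mulrnA.
Qed.

(** Apart from its constant term, [chi] lives in the degrees congruent to -1 modulo [e]. These gaps
    make most of the power sums below vanish. *)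
Lemma coef_crit_poly0 i : (0 < i)%N -> ~~ (e %| i.+1)%N -> chi`_i = 0.
Proof.
by move=> i0 /negPf ndv; rewrite coef_crit_poly ndv (gtn_eqF i0) subr0.
Qed.

Lemma crit_map_deriv : phi^`() = n%:R *: 'X^(e.-1) * ('X^e + 1) ^+ d.-1.
Proof.
rewrite deriv_exp derivD derivXn -polyC1 derivC addr0 -dvd_de natrM.
by rewrite -!scaler_nat -!scalerAl scalerA mulrC.
Qed.

Lemma crit_polyE c :
  root chi c = (n%:R * c ^+ e.-1 * (c ^+ e + 1) ^+ d.-1 == 1).
Proof.
rewrite /root hornerD hornerN hornerC crit_map_deriv.
by rewrite !hornerE subr_eq0.
Qed.

Lemma lead_crit_poly : size chi = n /\ lead_coef chi = n%:R.
Proof.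
have s_le : (size chi <= n)%N.
  apply/leq_sizeP => i ni.
  rewrite coef_crit_poly gtn_eqF ?(leq_trans _ ni) ?(leq_trans _ n_gt3) // subr0.
  case: ifP => // dv; rewrite bin_small ?mul0n // ltn_divRL // dvd_de.
  exact: ni.
have chi_n : chi`_n.-1 = n%:R.
  rewrite coef_crit_poly prednK ?(leq_trans _ n_gt3) // -dvd_de dvdn_mull //.
  by rewrite mulnK // binn mul1n dvd_de; case: n n_gt3 => [|[|m]] // _; rewrite subr0.
have s_n : size chi = n.
  apply/eqP; rewrite eqn_leq s_le /= leqNgt; apply/negP => lt.
  by move: nC; rewrite -chi_n nth_default ?eqxx // -ltnS prednK // (leq_trans _ n_gt3).
by rewrite lead_coefE s_n chi_n.
Qed.

Lemma mul_deriv_exp (p : {poly C}) k : p * (p ^+ k)^`() = k%:R * p^`() * p ^+ k.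
Proof.
case: k => [|k]; first by rewrite expr0 -polyC1 derivC mulr0 !mul0r.
by rewrite deriv_exp exprS -mulr_natl /=; ring.
Qed.

(** The logarithmic derivative of
    [phi^]()[, cleared of denominators. At a root of]chi[the factor]phi^[()] is 1, so a double root
    has a known [e]-th power. *)
Lemma crit_poly_deriv : 'X * ('X^e + 1) * chi^`() =
  phi^`() * ((n%:R - 1) * 'X^e + (e%:R - 1)).
Proof.
have E1 : 'X * ('X^(e.-1) : {poly C})^`() = (e%:R - 1) * 'X^(e.-1).
  by rewrite mul_deriv_exp derivX mulr1 -subn1 natrB.
have E2 := mul_deriv_exp ('X^e + 1) d.-1.
have E3 : 'X * ('X^e + 1 : {poly C})^`() = e%:R * 'X^e.
  by rewrite derivD -polyC1 derivC addr0 mul_deriv_exp derivX mulr1.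
have chi' : chi^`() = n%:R * (('X^(e.-1))^`() * ('X^e + 1) ^+ d.-1 + 'X^(e.-1) * (('X^e + 1) ^+ d.-1)^`()).
  rewrite /chi derivB -polyC1 derivC subr0 crit_map_deriv -mul_polyC -mulrA derivM.
  by rewrite derivC mul0r add0r derivM polyC_natr.
rewrite chi' crit_map_deriv -mul_polyC polyC_natr.
set W := 'X^e + 1 in E2 E3 *; set a := 'X^(e.-1) in E1 *; set B := W ^+ d.-1 in E2 *.
have dn : n%:R = d%:R * e%:R :> {poly C} by rewrite -dvd_de natrM.
have dpred : d.-1%:R = d%:R - 1 :> {poly C} by rewrite -subn1 natrB.
have -> : 'X * W * (n%:R * (a^`() * B + a * B^`())) =
    n%:R * (('X * a^`()) * W * B + a * 'X * (W * B^`())) by ring.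
rewrite E1 E2 dpred.
have -> : a * 'X * ((d%:R - 1) * W^`() * B) = a * (d%:R - 1) * ('X * W^`()) * B by ring.
by rewrite E3 /W dn; ring.
Qed.

(* At a double root, [c] would be rational and [c ^ e = - (e - 1) / (n - 1)]: the
   resulting identity between integers fails modulo [e]. *)
Lemma crit_poly_separable : separable_poly chi.
Proof.
rewrite separable.separable_poly.unlock; apply: Pdiv.ClosedField.root_coprimep => c; rewrite crit_polyE => /eqP c1; apply/negP => /eqP c'0.
have := congr1 (fun p => p.[c]) crit_poly_deriv.
have phi'c : phi^`().[c] = 1 by rewrite crit_map_deriv !hornerE.
rewrite !hornerM c'0 mulr0 phi'c mul1r.
rewrite !(hornerD, hornerN, hornerM, hornerXn, hornerC) -!polyC_natr !hornerC.
move=> /esym ce.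
have {}ce : (n%:R - 1) * c ^+ e = - (e%:R - 1) by apply/eqP; rewrite -addr_eq0 ce.
have n1 : n.-1%:R = n%:R - 1 :> C by rewrite -subn1 natrB // (leq_trans _ n_gt3).
have e1 : e.-1%:R = e%:R - 1 :> C by rewrite -subn1 natrB.
have ne : (n - e)%:R = n%:R - e%:R :> C by rewrite natrB // -dvd_de leq_pmull.
(* Multiply by [1 = n c^(e-1) (c^e + 1)^(d-1)], then use the known [c^e] and
   [(n - 1) (c^e + 1) = n - e]. *)
have cE : c * n.-1%:R ^+ d = - (n * e.-1 * (n - e) ^ d.-1)%:R.
  rewrite !natrM natrX ne e1.
  have -> : n%:R - e%:R = n.-1%:R * (c ^+ e + 1) by rewrite mulrDr n1 ce; ring.
  have eN : e%:R - 1 = - ((n%:R - 1) * c ^+ e) by rewrite ce opprK.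
  have cS : c ^+ e = c * c ^+ e.-1 by rewrite -exprS prednK.
  have nS : n.-1%:R ^+ d = n.-1%:R * n.-1%:R ^+ d.-1 :> C by rewrite -exprS prednK.
  rewrite exprMn nS eN -n1; set x := (c ^+ e + 1) ^+ d.-1 in c1 *.
  rewrite cS; set t := n.-1%:R ^+ d.-1.
  have -> : c * (n.-1%:R * t) = c * (n.-1%:R * t) * (n%:R * c ^+ e.-1 * x).
    by rewrite c1 mulr1.
  by ring.
(* The [e]-th power of [cE], with [c^e] eliminated once more; the signs agree because [e] is odd. *)
have eqN : (e.-1 * n.-1 ^ n.-1 = (n * e.-1 * (n - e) ^ d.-1) ^ e)%N.
  have eqC : - (e.-1 * n.-1 ^ n.-1)%:R = (c * n.-1%:R ^+ d) ^+ e.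
    have nS : n.-1%:R ^+ n = n.-1%:R * n.-1%:R ^+ n.-1 :> C.
      by rewrite -exprS prednK // (leq_trans _ n_gt3).
    by rewrite exprMn -exprM dvd_de nS natrM natrX -mulNr e1 -ce -n1; ring.
  apply/eqP; rewrite -(eqr_nat C) -eqr_opp eqC cE natrX.
  by rewrite exprNn -signr_odd e_odd expr1 mulN1r.
(* As [e] divides [n], it is coprime to [e - 1] and [n - 1], yet it divides the other side. *)
have : coprime e (e.-1 * n.-1 ^ n.-1)%N.
  have cop m : (0 < m)%N -> (e %| m)%N -> coprime e m.-1.
    move=> m0 em; apply: coprime_dvdl em _.
    by rewrite -{1}(prednK m0) coprimeSn.
  rewrite coprimeMr cop // coprimeXr // cop ?(leq_trans _ n_gt3) //.
  by rewrite -dvd_de dvdn_mull.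
rewrite eqN => cop; have : (e %| (n * e.-1 * (n - e) ^ d.-1) ^ e)%N.
  by rewrite dvdn_exp // -mulnA dvdn_mulr // -dvd_de dvdn_mull.
move/gcdn_idPl; move: cop; rewrite /coprime => /eqP -> e1'.
by move: e_gt2; rewrite -e1'.
Qed.

(* [c^(1-e)/n] is the value of [(c^e+1)^(d-1)] at a root [c]. *)
Lemma crit_value c : root chi c ->
  c - (c ^+ e + 1) ^+ d = (1 - n%:R^-1) * c - n%:R^-1 * c^-1 ^+ e.-1.
Proof.
rewrite crit_polyE => /eqP c1.
have c0 : c != 0.
  apply/eqP => c0; move/eqP: c1; rewrite c0 expr0n.
  by case: e e_gt2 => [|[|m]] //= _; rewrite mulr0 mul0r eq_sym oner_eq0.
have -> : (c ^+ e + 1) ^+ d = (c * c ^+ e.-1 + 1) * (c ^+ e + 1) ^+ d.-1.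
  by rewrite -exprS prednK // -exprS prednK.
set x := (c ^+ e + 1) ^+ d.-1 in c1 *.
have -> : c^-1 ^+ e.-1 = n%:R * x.
  have ce0 := expf_neq0 e.-1 c0; apply: (mulfI ce0).
  by rewrite exprVn divff // mulrA [_ * n%:R]mulrC c1.
rewrite mulKf // mulrDl mul1r opprD addrA; congr (_ - _).
have cx : c ^+ e.-1 * x = n%:R^-1 by apply: (mulfI nC); rewrite mulfV // mulrA.
by rewrite mulrBl mul1r -mulrA cx mulrC.
Qed.

Lemma coef_mul_deg2 (p : {poly C}) a b c k : (1 < k)%N ->
  (p * (a%:P + b%:P * 'X + c%:P * 'X^2))`_k = a * p`_k + b * p`_(k - 1) + c * p`_(k - 2).
Proof.
move=> k1; have -> : p * (a%:P + b%:P * 'X + c%:P * 'X^2) =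
  a *: p + b *: (p * 'X) + c *: (p * 'X^2) by rewrite -!mul_polyC; ring.
by rewrite !coefD !coefZ coefMX coefMXn ltnNge k1 subn1; case: k k1.
Qed.

(** By [crit_value], both sums reduce to the power sums of the roots of [chi] with exponents 1 and
    2, and, for the inverses of the roots, [e - 2], [e - 1] and [2 (e - 1)]. Newton's identities
    give them. *)
Lemma crit_sums : exists s : seq C,
  [/\ uniq s, forall c, (c \in s) = root chi c,
    \sum_(c <- s) (c - (c ^+ e + 1) ^+ d) = - e.-1%:R &
    \sum_(c <- s) (c - (c ^+ e + 1) ^+ d) ^+ 2 = e.-1%:R].
Proof.
have [sz_chi lc_chi] := lead_crit_poly.
have [s chi_s] := closed_field_poly_normal chi; rewrite lc_chi in chi_s.
have rootE c : (c \in s) = root chi c by rewrite chi_s rootZ // root_prod_XsubC.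
have s_uniq : uniq s.
  have := crit_poly_separable; rewrite chi_s -mul_polyC separable_mul.
  by case/and3P => _; rewrite separable_prod_XsubC.
have sz_s : size s = n.-1.
  by have := sz_chi; rewrite {1}chi_s size_scale // size_prod_XsubC => <-.
have s_neq0 c : c \in s -> c != 0.
  rewrite rootE crit_polyE; apply: contraTneq => ->.
  by case: e e_gt2 => [|[|m]] //= _; rewrite expr0n mulr0 mul0r eq_sym oner_eq0.
pose T k := \sum_(c <- s) c^-1 ^+ k; pose S k := \sum_(c <- s) c ^+ k.
have n1 : (n.-1.+1 = n)%N by rewrite prednK // (leq_trans _ n_gt3).
(* Newton's identities at the top, in degrees [n] and [n - 1], which are beyond the remainder [r].
   The coefficients of [chi] in degrees [n - 2] and [n - 3] are zero because [e] divides [n] and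
   [2 < e]. *)
have [S1 S2] : S 1%N = 0 /\ S 2 = 0.
  have [r def_r sz_r] := power_sums 3 s.
  have sum3 : \poly_(i < 3) (\sum_(c <- s) c ^+ (2 - i)) =
      (S 2)%:P + (S 1%N)%:P * 'X + (S 0%N)%:P * 'X^2.
    rewrite poly_def 3!big_ord_recl big_ord0 addr0 !mul_polyC /= expr0 alg_polyC addrA.
    by rewrite /bump /=.
  have {}def_r : chi^`() * 'X^3 = chi * ((S 2)%:P + (S 1%N)%:P * 'X + (S 0%N)%:P * 'X^2) + n%:R *: r.
    by rewrite chi_s derivZ -scalerAl [_ * 'X^3]mulrC def_r sum3 scalerDr scalerAl.
  have en : (e %| n)%N by rewrite -dvd_de dvdn_mull.
  have chi2 : chi`_(n - 2) = 0.
    apply: coef_crit_poly0; first by rewrite subn_gt0 (leq_trans _ n_gt3).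
    rewrite subnSK ?(leq_trans _ n_gt3) // dvdn_subr // ?(leq_trans _ n_gt3) //.
    by rewrite gtnNdvd // (leq_trans _ e_gt2).
  have chi3 : chi`_(n - 3) = 0.
    apply: coef_crit_poly0; first by rewrite subn_gt0.
    rewrite subnSK ?(leq_trans _ n_gt3) // dvdn_subr // ?(leq_trans _ n_gt3) //.
    by rewrite gtnNdvd.
  have chi1 : chi`_(n - 1) = n%:R by rewrite subn1 -{1}sz_chi -lead_coefE.
  have chi0 : chi`_n = 0 by rewrite nth_default // sz_chi.
  have coef3 k : (2 < k)%N -> (n.-1 <= k)%N ->
     chi`_(k - 2) *+ (k - 2) = S 2 * chi`_k + S 1%N * chi`_(k - 1) + S 0%N * chi`_(k - 2).
    move=> k3 nk; have := congr1 (fun p : {poly C} => p`_k) def_r.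
    rewrite /= coefMXn ltnNge k3 /= coef_deriv subnSK // (coefD (_ * _)) coefZ.
    rewrite [r`_k]nth_default ?mulr0 ?addr0; last first.
      by rewrite (leq_trans sz_r) // sz_s.
    by move=> ->; rewrite coef_mul_deg2 // ltnW.
  have S1 : S 1%N = 0.
    have := coef3 n; rewrite chi2 mul0rn chi0 chi1 !mulr0 add0r addr0.
    rewrite (leq_trans _ n_gt3) // leq_pred => /(_ isT isT)/esym/eqP.
    by rewrite mulf_eq0 (negPf nC) orbF => /eqP.
  split=> //; have := coef3 n.-1.
  rewrite -!subn1 -!subnDA chi1 chi2 chi3 S1 mul0rn !mulr0 !addr0 subn1 leqnn.
  rewrite -ltnS n1 n_gt3 => /(_ isT isT)/esym/eqP.
  by rewrite mulf_eq0 (negPf nC) orbF => /eqP.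
have [T1 T2 T3] : [/\ T e.-2 = 0, T e.-1 = (n * e.-1)%:R & T (e.-1 * 2)%N = (n ^ 2 * e.-1)%:R].
  pose m := (e.-1 * 2)%N; have [r def_r] := neg_power_sums m s_neq0.
  set tau := \poly_(i < m) _ in def_r.
  have tauE k : (k < m)%N -> tau`_k = T k.+1 by move=> km; rewrite coef_poly km.
  have {}def_r : chi^`() + chi * tau = n%:R *: r * 'X^m.
    by rewrite -scalerAl -def_r chi_s derivZ scalerDr scalerAl.
  have chi_low : exists r', chi = -1 + n%:R *: 'X^(e.-1) + r' * 'X^m.
    exists (drop_poly m chi); rewrite -{1}(poly_take_drop m chi); congr (_ + _).
    apply/polyP => i; rewrite coef_take_poly [RHS]coefD coefN coef1 coefZ coefXn.
    case: ltnP => im; last first.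
      have -> : (i == e.-1) = false by move: im; rewrite /m; lia.
      have -> : (i == 0%N) = false by move: im; rewrite /m; lia.
      by rewrite mulr0 oppr0 addr0.
    rewrite coef_crit_poly addrC; congr (_ + _); have [->|ie] := eqVneq i e.-1.
      by rewrite prednK // dvdnn divnn e_gt0 bin1 dvd_de mulr1.
    rewrite mulr0; case: ifP => // /dvdnP[q iq]; exfalso.
    move: im ie; rewrite /m; case: q iq => [|[|q]]; lia.
  have coef_low k : (k < m)%N ->
      chi`_k.+1 *+ k.+1 + (- T k.+1 + n%:R * (if (k < e.-1)%N then 0 else T (k - e.-1).+1)) = 0.
    move=> km; have [r' def_chi] := chi_low.
    have eq0 := congr1 (fun p : {poly C} => p`_k) def_r.
    rewrite /= coefMXn km coefD coef_deriv in eq0; rewrite -[RHS]eq0; congr (_ + _).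
    rewrite [in RHS]def_chi !mulrDl !coefD mulNr mul1r coefN tauE //.
    rewrite -mulrA ['X^m * _]mulrC mulrA coefMXn km addr0 -scalerAl coefZ; congr (_ + _ * _).
    by rewrite coefXnM; case: ltnP => // le; rewrite tauE // (leq_ltn_trans _ km) // leq_subr.
  have chi_gap k : (0 < k)%N -> (k < e)%N -> k.+1 != e -> chi`_k = 0 /\ chi`_(e + k) = 0.
    move=> k0 ke ke'; have nd : ~~ (e %| k.+1)%N.
      by apply/negP => /(dvdn_leq (ltn0Sn k)); move: ke ke'; lia.
    split; apply: coef_crit_poly0 => //; first by rewrite addn_gt0 k0 orbT.
    by rewrite -addnS dvdn_addr.
  have T1 : T e.-2 = 0.
    have := coef_low (e - 3)%N; have -> : ((e - 3).+1 = e.-2)%N by lia.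
    have [|||-> _] := chi_gap e.-2; try lia.
    have -> : (e.-2 <= e.-1)%N by lia.
    rewrite mul0rn add0r mulr0 addr0 => eq0; apply/eqP; rewrite -oppr_eq0 eq0 //.
    by rewrite /m; lia.
  have T2 : T e.-1 = (n * e.-1)%:R.
    have := coef_low e.-2; have -> : (e.-2.+1 = e.-1)%N by lia.
    rewrite leqnn.
    rewrite coef_crit_poly prednK // dvdnn divnn e_gt0 bin1 dvd_de.
    have -> : (e.-1 == 0%N) = false by lia.
    rewrite subr0 mulr0 addr0 -mulrnA => eq0; apply/esym/eqP; rewrite -subr_eq0 eq0 //.
    by rewrite /m; lia.
  split=> //; have := coef_low m.-1.
  have -> : (m.-1.+1 = m)%N by rewrite /m; lia.
  have -> : (m <= e.-1)%N = false by rewrite /m; lia.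
  have -> : ((m.-1 - e.-1).+1 = e.-1)%N by rewrite /m; lia.
  have -> : chi`_m = 0.
    have [|||_] := chi_gap e.-2; try lia.
    by have -> : (e + e.-2 = m)%N by rewrite /m; lia.
  rewrite mul0rn add0r T2 => eq0; apply/esym/eqP; rewrite -subr_eq0 addrC -mulnn.
  by rewrite -mulnA natrM eq0 // /m; lia.
have value c : c \in s -> c - (c ^+ e + 1) ^+ d = (1 - n%:R^-1) * c - n%:R^-1 * c^-1 ^+ e.-1.
  by rewrite rootE => /crit_value.
exists s; split=> //.
  rewrite (eq_big_seq _ value) sumrB -!mulr_sumr -/(T e.-1).
  have -> : \sum_(c <- s) c = 0 by rewrite -[RHS]S1; apply: eq_bigr.
  by rewrite T2 mulr0 sub0r natrM mulKf.
pose a := 1 - n%:R^-1 : C; pose b := n%:R^-1 : C.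
have value2 c : c \in s -> (c - (c ^+ e + 1) ^+ d) ^+ 2 =
    a ^+ 2 * c ^+ 2 + (- (2 * a * b) * c^-1 ^+ e.-2 + b ^+ 2 * c^-1 ^+ (e.-1 * 2)).
  move=> cs; have c0 := s_neq0 c cs; rewrite value // -/a -/b exprM.
  have -> : c^-1 ^+ e.-1 = c^-1 * c^-1 ^+ e.-2 by rewrite -exprS; congr (_ ^+ _); lia.
  by rewrite sqrrB; field.
rewrite (eq_big_seq _ value2) !big_split -!mulr_sumr /= -/(S 2) -/(T e.-2) -/(T (e.-1 * 2)%N).
by rewrite S2 T1 T3 !mulr0 !add0r natrM natrX /b exprVn mulKf // expf_neq0.
Qed.

End CriticalPolynomial.

(** * Inequivalence *)

Section PolynomialPaths.
Variable C : numClosedFieldType.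
Implicit Types (f g : {mpoly C[2]}) (v w : 'I_2 -> C) (gamma : 'I_2 -> {poly C}).

Definition path_eval gamma (t : C) : 'I_2 -> C := fun i => (gamma i).[t].

Lemma mpoly_along f gamma : exists q : {poly C}, forall t, q.[t] = f.@[path_eval gamma t].
Proof.
elim/mpoly_gen_ind: f => [c|i|f g [p Hp] [q Hq]|f g [p Hp] [q Hq]].
- by exists c%:P => t; rewrite hornerC mevalC.
- by exists (gamma i) => t; rewrite mevalXU.
- by exists (p + q) => t; rewrite hornerD mevalD Hp Hq.
- by exists (p * q) => t; rewrite hornerM mevalM Hp Hq.
Qed.

(* Criticality is expressed through polynomial arcs: it is then obviously
   invariant under polynomial automorphisms. *)
Definition critical f v := forall gamma (q : {poly C}),
  path_eval gamma 0 = v -> (forall t, q.[t] = f.@[path_eval gamma t]) -> q^`().[0] = 0.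

Lemma path_polymap (F : 2.-tuple {mpoly C[2]}) gamma :
  exists delta, forall t, path_eval delta t = polymap F (path_eval gamma t).
Proof.
have along i := cid (mpoly_along (tnth F i) gamma).
exists (fun i => projT1 (along i)) => t; apply/funext => i.
exact: projT2 (along i) t.
Qed.

(** An arc through [F(v)] is the image under [F] of its pull-back by [G], an arc through [v]; along
    it the values of [f'] are [c] times those of [f]. *)
Lemma critical_transport f f' F G c v : c != 0 ->
    (forall w, polymap G (polymap F w) = w) -> (forall w, polymap F (polymap G w) = w) ->
    (forall w, f'.@[polymap F w] = c * f.@[w]) ->
  critical f v -> critical f' (polymap F v).
Proof.
move=> c0 FK GK f'F crit_v gamma q gamma0 qE.
have [delta deltaE] := path_polymap G gamma.
have [r rE] := mpoly_along f delta.
have -> : q = c *: r.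
  apply: poly_fun_inj => t; rewrite hornerZ rE deltaE -f'F GK; exact: qE.
by rewrite derivZ hornerZ (crit_v delta r _ rE) ?mulr0 // deltaE gamma0 FK.
Qed.

Definition point (x y : C) : 'I_2 -> C := fun i => if i == ord0 then x else y.

Lemma pointE v : v = point (v ord0) (v ord_max).
Proof.
apply/funext => i; rewrite /point; case: eqP => [->//|/eqP].
by case: (unliftP ord0 i) => [j|] -> // _; congr v; apply/val_inj; rewrite /= ord1.
Qed.

(** The Nullstellensatz gives cofactors with [f' o F = a f] and [f o G = b f']. Substituting one
    equation into the other shows that [a] is invertible, hence constant. *)
Lemma equivalent_curves_scale f f' :
    (forall g, (forall v, f.@[v] = 0 -> g.@[v] = 0) -> exists q, g = q * f) ->
    (forall g, (forall v, f'.@[v] = 0 -> g.@[v] = 0) -> exists q, g = q * f') ->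
    (exists v, f.@[v] != 0) -> equivalent_curves f f' ->
  exists F G c, [/\ c != 0, forall w, polymap G (polymap F w) = w,
    forall w, polymap F (polymap G w) = w & forall w, f'.@[polymap F w] = c * f.@[w]].
Proof.
move=> nullf nullf' [v0 fv0] [F [[G [FK GK]] zeros]].
have {}FK v : polymap G (polymap F v) = v by apply/funext => i; exact: FK.
have {}GK v : polymap F (polymap G v) = v by apply/funext => i; exact: GK.
have [|a aE] := nullf (f' \mPo F).
  by move=> v fv; rewrite comp_mpoly_meval; apply/(zeros (polymap F v)); exists v.
have [|b bE] := nullf' (f \mPo G).
  move=> w /zeros[v fv Fv]; rewrite comp_mpoly_meval.
  have <- : polymap F v = w by apply/funext.
  by rewrite -[fun i => _]/(polymap G (polymap F v)) FK.
have {}aE v : f'.@[polymap F v] = a.@[v] * f.@[v].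
  by rewrite -mevalM -aE comp_mpoly_meval.
have {}bE w : f.@[polymap G w] = b.@[w] * f'.@[w].
  by rewrite -mevalM -bE comp_mpoly_meval.
have abf v : f.@[v] = b.@[polymap F v] * a.@[v] * f.@[v].
  by rewrite -mulrA -aE -bE FK.
(* On a line through [v0], the cofactor [a] divides [1]. *)
have a_const v : a.@[v] = a.@[v0].
  pose gamma i : {poly C} := (v0 i)%:P + (v i - v0 i)%:P * 'X.
  have gamma0 : path_eval gamma 0 = v0.
    by apply/funext => i; rewrite /path_eval /gamma !hornerE.
  have gamma1 : path_eval gamma 1 = v.
    by apply/funext => i; rewrite /path_eval /gamma hornerD hornerM !hornerC hornerX mulr1 addrC subrK.
  have [delta deltaE] := path_polymap F gamma.
  have [p pE] := mpoly_along f gamma; have [q qE] := mpoly_along a gamma.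
  have [r rE] := mpoly_along b delta.
  have p0 : p != 0.
    apply: contraNneq fv0 => p0; have := pE 0; rewrite p0 horner0 gamma0 => <-.
    by rewrite eqxx.
  have rq : r * q = 1.
    apply: (mulIf p0); rewrite mul1r; apply: poly_fun_inj => t.
    by rewrite !hornerM rE qE pE deltaE -abf.
  have /size_poly1P[x _ qx] : size q == 1%N.
    have : q \is a GRing.unit by apply/unitrPr; exists r; rewrite mulrC.
    by rewrite poly_unitE => /andP[].
  by rewrite -{1}gamma1 -gamma0 -!qE qx !hornerC.
exists F, G, a.@[v0]; split=> // [|w]; last by rewrite aE a_const.
apply: contraNneq fv0 => a0; by rewrite abf a0 mulr0 mul0r.
Qed.

End PolynomialPaths.

(** * The critical points of the plane embeddings *)

Section EmbeddingCriticalPoints.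
Variables (C : numClosedFieldType) (d e : nat).

Local Notation f := (emb_curve C d e).

Lemma emb_path_deriv gamma (q : {poly C}) :
    (forall t, q.[t] = f.@[path_eval gamma t]) ->
  let x := (gamma ord0).[0] in let y := (gamma ord_max).[0] in
  q^`().[0] = (gamma ord_max)^`().[0] -
    (2 * x * (gamma ord0)^`().[0] + e%:R * y ^+ e.-1 * (gamma ord_max)^`().[0]) *
      (d%:R * (x ^+ 2 + y ^+ e + 1) ^+ d.-1).
Proof.
move=> qE x y.
have -> : q = gamma ord_max - (gamma ord0 ^+ 2 + gamma ord_max ^+ e + 1) ^+ d.
  apply: poly_fun_inj => t; rewrite qE emb_curve_eval /path_eval.
  by rewrite !(hornerD, hornerN, horner_exp, hornerC).
rewrite derivB deriv_exp !derivD !deriv_exp -polyC1 derivC addr0 /=.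
rewrite !(hornerD, hornerN, hornerMn, hornerM, horner_exp, hornerC) -/x -/y.
ring.
Qed.

Lemma emb_critical x y : critical f (point x y) <->
  x = 0 /\ root (crit_poly C d e) y.
Proof.
have rootE : root (crit_poly C d e) y =
    (e%:R * y ^+ e.-1 * (d%:R * (0 ^+ 2 + y ^+ e + 1) ^+ d.-1) == 1).
  rewrite (crit_polyE (erefl (d * e)%N)) natrM expr0n add0r.
  by congr (_ == 1); ring.
split=> [crit|[-> rt] gamma q gamma0 qE].
  (* The lines parallel to the axes serve as test arcs and give the two partial derivatives. *)
  pose gx (i : 'I_2) : {poly C} := if i == ord0 then x%:P + 'X else y%:P.
  pose gy (i : 'I_2) : {poly C} := if i == ord0 then x%:P else y%:P + 'X.
  have [qx qxE] := mpoly_along f gx; have [qy qyE] := mpoly_along f gy.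
  have gx0 : path_eval gx 0 = point x y.
    by rewrite [LHS]pointE /path_eval /gx /= !hornerE.
  have gy0 : path_eval gy 0 = point x y.
    by rewrite [LHS]pointE /path_eval /gy /= !hornerE.
  have := crit _ _ gx0 qxE; have := crit _ _ gy0 qyE.
  rewrite (emb_path_deriv qxE) (emb_path_deriv qyE) /gx /gy /=.
  rewrite !(derivD, derivC, derivX, hornerD, hornerX, horner0, hornerC).
  rewrite !(add0r, addr0, mulr0, mulr1).
  set A := _ * _ ^+ e.-1; set D := d%:R * _ => /eqP; rewrite subr_eq0 => /eqP AD /eqP.
  (* The vertical arc gives [A * D = 1], so [D] is nonzero and the horizontal arc forces [x = 0]. *)
  have D0 : D != 0 by apply: contra_eq_neq AD => ->; rewrite mulr0 oner_eq0.
  rewrite oppr_eq0 mulf_eq0 (negPf D0) orbF mulf_eq0 pnatr_eq0 /= => /eqP x0.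
  by split=> //; rewrite rootE -{1}x0 -/A -/D -AD.
rewrite (emb_path_deriv qE).
have -> : (gamma ord0).[0] = 0 by rewrite -[LHS]/(path_eval gamma 0 ord0) gamma0.
have -> : (gamma ord_max).[0] = y by rewrite -[LHS]/(path_eval gamma 0 ord_max) gamma0.
move: rt; rewrite rootE => /eqP; set A := _ * _ ^+ e.-1; set D := d%:R * _ => AD.
have -> : forall a b, a - (2 * 0 * b + A * a) * D = a * (1 - A * D) by move=> a b; ring.
by rewrite AD subrr mulr0.
Qed.

End EmbeddingCriticalPoints.

Lemma emb_not_equivalent (C : numClosedFieldType) (h d e d' e' : nat) :
  (0 < h)%N -> (2 < e)%N -> (2 < e')%N ->
  (d * e)%N = hyp_deg h -> (d' * e')%N = hyp_deg h -> e != e' ->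
  ~ equivalent_curves (emb_curve C d e) (emb_curve C d' e').
Proof.
move=> h_gt0 e_gt2 e'_gt2 de de' ee' equiv.
have n_gt3 : (3 < hyp_deg h)%N by rewrite /hyp_deg; lia.
have oddE k l : (k * l)%N = hyp_deg h -> odd l.
  move=> kl; have : odd (k * l)%N by rewrite kl /hyp_deg /= odd_double.
  by rewrite oddM => /andP[].
have [F [G [c [c0 FK GK fF]]]] : exists F G c, [/\ c != 0,
    forall w, polymap G (polymap F w) = w, forall w, polymap F (polymap G w) = w &
    forall w, (emb_curve C d' e').@[polymap F w] = c * (emb_curve C d e).@[w]].
  apply: equivalent_curves_scale => //.
  - by move=> g; exact: (emb_nullstellensatz de).
  - by move=> g; exact: (emb_nullstellensatz de').
  exists (fun=> 0); rewrite emb_curve_eval !expr0n [e == _]gtn_eqF ?(ltnW (ltnW e_gt2)) //=.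
  by rewrite !add0r expr1n oppr_eq0 oner_eq0.
have fG w : (emb_curve C d e).@[polymap G w] = c^-1 * (emb_curve C d' e').@[w].
  by rewrite -{2}[w]GK fF mulKf.
have [s [s_uniq rootE sum1 sum2]] := crit_sums C de n_gt3 e_gt2 (oddE _ _ de).
have [s' [s'_uniq rootE' sum1' sum2']] := crit_sums C de' n_gt3 e'_gt2 (oddE _ _ de').
have critE y : y \in s -> polymap F (point 0 y) ord0 = 0 /\ polymap F (point 0 y) ord_max \in s'.
  rewrite rootE rootE' => ry; apply/emb_critical.
  rewrite -pointE; apply: (critical_transport c0 FK GK fF).
  exact/emb_critical.
have critE' y : y \in s' -> polymap G (point 0 y) ord0 = 0 /\ polymap G (point 0 y) ord_max \in s.
  rewrite rootE rootE' => ry; apply/emb_critical.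
  rewrite -pointE; apply: (critical_transport (invr_neq0 c0) GK FK fG).
  exact/emb_critical.
pose sigma y := polymap F (point 0 y) ord_max.
have sigmaE y : y \in s -> polymap F (point 0 y) = point 0 (sigma y).
  by move=> /critE[Fy _]; rewrite [LHS]pointE Fy.
(* [F] and [G] restrict to inverse bijections between the two sets of critical points. *)
have perm_s : perm_eq s' (map sigma s).
  apply: uniq_perm => //.
    rewrite map_inj_in_uniq // => y z ys zs eq_yz.
    have : polymap F (point 0 y) = polymap F (point 0 z) by rewrite !sigmaE // eq_yz.
    by move=> /(congr1 (polymap G)); rewrite !FK => /(congr1 (@^~ ord_max)).
  move=> z; apply/idP/mapP => [zs'|[y ys ->]]; last by have [] := critE y ys.
  have [Gz0 Gzs] := critE' z zs'; exists (polymap G (point 0 z) ord_max) => //.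
  by rewrite /sigma -[X in point X _]Gz0 -pointE GK.
have value y : y \in s -> sigma y - (sigma y ^+ e' + 1) ^+ d' = c * (y - (y ^+ e + 1) ^+ d).
  move=> ys; have := fF (point 0 y); rewrite sigmaE // !emb_curve_eval /point /=.
  by rewrite expr0n !add0r.
(* Comparing sums gives the factor [c], comparing sums of squares gives [c ^+ 2]; since [c] and
   [e - 1] are nonzero, [c = 1]. *)
have E1 : e'.-1%:R = c * e.-1%:R.
  apply: oppr_inj; rewrite -mulrN -sum1 -sum1' (perm_big _ perm_s) big_map.
  by rewrite (eq_big_seq _ value) mulr_sumr.
have E2 : e'.-1%:R = c ^+ 2 * e.-1%:R.
  rewrite -sum2 -sum2' (perm_big _ perm_s) big_map mulr_sumr.
  by apply: eq_big_seq => y /value ->; rewrite exprMn.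
have e0 : e.-1%:R != 0 :> C by rewrite pnatr_eq0; lia.
have c1 : c = 1.
  have /eqP : c * e.-1%:R = c ^+ 2 * e.-1%:R by rewrite -E1 -E2.
  by rewrite expr2 -subr_eq0 -mulrBl mulf_eq0 (negPf e0) orbF -{1}[c]mulr1 -mulrBr
    mulf_eq0 (negPf c0) subr_eq0 => /eqP.
move/eqP: E1; rewrite c1 mul1r eqr_nat => /eqP; move/eqP: ee'; lia.
Qed.

Theorem theorem1p4 (R : realType) (k : nat) (hk : (2 <= k)%N) :
  exists f : 'I_k -> {mpoly R[i][2]},
    [/\ forall i, irreducible_elt (f i),
        forall i, one_place_at_infinity (f i),
        forall i j, isomorphic_curves (f i) (f j) &
        forall i j, i != j -> ~ equivalent_curves (f i) (f j)].
Proof.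
(* Indices start at 0, so the shift keeps every [e i] at least 3. The odd number [3 ^ k] is
   [hyp_deg h] for the [h] below, which is positive because [2 <= k]. *)
pose e (i : 'I_k) := (3 ^ i.+1)%N; pose d (i : 'I_k) := (3 ^ (k - i.+1))%N.
pose h := (3 ^ k - 3)./2.
have pow_ge9 : (9 <= 3 ^ k)%N by rewrite -[9%N]/(3 ^ 2)%N leq_exp2l.
have degE : (3 ^ k)%N = hyp_deg h.
  have odd3k : odd (3 ^ k) by rewrite oddX orbT.
  rewrite /hyp_deg /h; move: odd3k pow_ge9; move: (3 ^ k)%N => m; lia.
have de i : (d i * e i)%N = hyp_deg h by rewrite /d /e -expnD subnK ?degE //; exact: ltn_ord.
have e_gt2 i : (2 < e i)%N by rewrite -[3%N]/(3 ^ 1)%N leq_exp2l.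
exists (fun i => emb_curve R[i] (d i) (e i)); split=> [i|i|i j|i j ij].
- exact: emb_curve_irreducible (de i).
- exact: emb_one_place (de i) (e_gt2 i).
- exact: emb_isomorphic (de i) (de j).
apply: (@emb_not_equivalent _ h) => //; first by rewrite /h; lia.
by apply: contra_neq ij => /eqP; rewrite eqn_exp2l // eqSS => /eqP/val_inj.
Qed.
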